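(* Let $X\subset \mathbb{P}^N$ be a nondegenerate smooth connected $n$-dimensional projective variety of degree $d$. Let $L=\mathcal{O}_{\mathbb{P}^N}(1)|_X$ and let $\delta_N$ be the degree of the lowest-degree homogeneous form vanishing on $X$. Then $\delta_N$ satisfies the inequality $$\frac{1}{\delta_N-1}\left(\frac{(\delta_N+N-1)(\delta_N+N-2)\cdots(\delta_N+n-1)}{N(N-1)\cdots(n+1)}-n\right)\leq d.$$
   Context: Work over the complex numbers. $X\subset\mathbb{P}^N$ is nondegenerate if it is contained in no hyperplane. With $\mathcal{J}_X$ the ideal sheaf of $X$ in $\mathbb{P}^N$, $\delta_N$ is the smallest positive integer $t$ such that $h^0(\mathcal{O}_{\mathbb{P}^N}(t)\otimes\mathcal{J}_X)>0$; here $X\neq\mathbb{P}^N$ (so $n<N$), so that $\delta_N$ exists, and $\delta_N\ge 2$ by nondegeneracy. In the fraction, the numerator is the product of the consecutive integers from $\delta_N+n-1$ up to $\delta_N+N-1$, and the denominator is the product of the consecutive integers from $n+1$ up to $N$. *)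

(* Defs.v *)
From HB Require Import structures.
From mathcomp Require Import all_boot all_order all_algebra.
From mathcomp Require Import classical_sets reals.
From mathcomp Require Import complex.
From mathcomp Require Import mpoly.

Set Implicit Arguments.
Unset Strict Implicit.
Unset Printing Implicit Defensive.

Import GRing.Theory Num.Theory.
Local Open Scope classical_set_scope.
Local Open Scope ring_scope.

(* Classical projective geometry over the complex numbers R[i].               *)
(* A point of P^N is a nonzero row vector of homogeneous coordinates, up to   *)
(* scaling.  A subset of P^N is represented by the set of all the nonzero     *)
(* vectors representing its points (its punctured affine cone); zero loci of  *)
(* homogeneous polynomials are stable under scaling, so this loses nothing.   *)
(* A projective variety is a closed subset with its reduced structure: its    *)
(* ideal consists of all the forms that vanish on it.                         *)
(* [dhomog N.+1 R[i] t] is the finite-dimensional space of forms of degree t. *)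

Section ProjectiveVarieties.
Variables (R : realType) (N : nat).
Implicit Types (X Z A B : set 'rV[R[i]]_N.+1) (n d t : nat).

Definition proj_space : set 'rV[R[i]]_N.+1 := [set v | v != 0].

Definition vanishes_on X (p : {mpoly R[i][N.+1]}) : Prop :=
  forall v, X v -> p.@[v 0] = 0.

Definition proj_closed X : Prop :=
  exists2 F : set {mpoly R[i][N.+1]},
    (forall p, F p -> exists t, p \is t.-homog) &
    X = [set v : 'rV[R[i]]_N.+1 | v != 0 /\ forall p, F p -> p.@[v 0] = 0].

Definition irreducible_closed Z : Prop :=
  [/\ proj_closed Z, Z !=set0 &
      forall A B, proj_closed A -> proj_closed B ->
        Z `<=` A `|` B -> Z `<=` A \/ Z `<=` B].

(* Connectedness of a closed X for the Zariski topology. *)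
Definition zariski_connected X : Prop :=
  X !=set0 /\
  forall A B, proj_closed A -> proj_closed B ->
    X = A `|` B -> A `&` B = set0 -> A = set0 \/ B = set0.

(* Topological (Krull) dimension: the maximal length m of a chain             *)
(* Z 0 < ... < Z m of irreducible closed subsets of X.                        *)
Definition irreducible_chain X (m : nat) : Prop :=
  exists Z : nat -> set 'rV[R[i]]_N.+1,
    (forall i, (i <= m)%N -> irreducible_closed (Z i) /\ Z i `<=` X) /\
    (forall i, (i < m)%N -> Z i `<` Z i.+1).

Definition has_dim X n : Prop :=
  irreducible_chain X n /\ forall m, irreducible_chain X m -> (m <= n)%N.

(* The linear subspace of C^{N+1} lying over the embedded projective tangent  *)
(* space of X at the point [v]: the common kernel of the differentials at v   *)
(* of the forms in the ideal of X.                                            *)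
Definition affine_tangent_space X (v : 'rV[R[i]]_N.+1) : set 'rV[R[i]]_N.+1 :=
  [set w | forall t (p : dhomog N.+1 R[i] t), vanishes_on X p ->
     \sum_(i < N.+1) ((p : {mpoly R[i][N.+1]})^`M(i)).@[v 0] * w 0 i = 0].

(* Smoothness of pure dimension n: every embedded projective tangent space    *)
(* has dimension n, that is, the Jacobian matrix has rank N - n everywhere.   *)
Definition smooth_of_dim X n : Prop :=
  forall v, X v ->
    exists2 T : {vspace 'rV[R[i]]_N.+1},
      (forall w, w \in T <-> affine_tangent_space X v w) & \dim T = n.+1.

(* I is the degree t part of the homogeneous ideal of X. *)
Definition is_ideal_part X t (I : {vspace dhomog N.+1 R[i] t}) : Prop :=
  forall p : dhomog N.+1 R[i] t, p \in I <-> vanishes_on X p.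

(* P(t) = dim (S / I(X))_t for t large, S being the polynomial ring. *)
Definition is_hilbert_poly X (P : {poly rat}) : Prop :=
  exists t0 : nat, forall t, (t0 <= t)%N ->
    exists2 I : {vspace dhomog N.+1 R[i] t},
      is_ideal_part X I &
      P.[t%:R] = (\dim {:dhomog N.+1 R[i] t})%:R - (\dim I)%:R.

(* The degree d of an n-dimensional X is read off its Hilbert polynomial:     *)
(* P(t) = (d / n!) t^n + terms of degree less than n.                         *)
Definition has_degree X n d : Prop :=
  exists2 P : {poly rat},
    is_hilbert_poly X P &
    (size (P - (d%:R / (n`!)%:R) *: 'X^n)%R <= n)%N.

Definition linearly_nondegenerate X : Prop :=
  ~ exists2 l : dhomog N.+1 R[i] 1, l != 0 & vanishes_on X l.

(* H^0(O(t) (x) J_X) is the space of degree t forms vanishing on X. *)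
Definition has_form X t : Prop :=
  exists2 p : dhomog N.+1 R[i] t, p != 0 & vanishes_on X p.

Definition is_initial_degree X (delta : nat) : Prop :=
  [/\ (0 < delta)%N, has_form X delta &
      forall t, (0 < t)%N -> has_form X t -> (delta <= t)%N].

End ProjectiveVarieties.

Arguments proj_space : clear implicits.

(* Main.v *)
Require Import Defs.
From HB Require Import structures.
From mathcomp Require Import all_boot all_order all_algebra.
From mathcomp Require Import boolp classical_sets reals.
From mathcomp Require Import perm complex polyrcf spectral.
From mathcomp Require Import mpoly ring zify.

Set Implicit Arguments.
Unset Strict Implicit.
Unset Printing Implicit Defensive.

Import Order.TTheory GRing.Theory Num.Theory.
Local Open Scope ring_scope.

(** Write [S] for the ring of polynomials in the [N.+1] coordinates, [I] for the
    ideal of [X] and [t = delta - 1].  No form of degree [t] vanishes on [X], so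
    the Hilbert function of [X] at [t] is the binomial ['C(t + N, t)], and the
    inequality amounts to the upper bound
      [h_X(t) <= (d - 1) * 'C(t - 1 + n, n) + 'C(t + n, n)].

    Suppose first that [I] is prime.  By Noether normalization with linear forms
    ([noether_normalization]) the coordinate ring [S / I] is finite over a
    polynomial ring [B] in [n.+1] variables; its rank over [B] is at most [d],
    because a free submodule of rank [r] contributes [r / n! * t^n] to the Hilbert
    function ([free_family_le_degree]).  Choose a point [o] of the projective
    space of dimension [n] over which [S / I] is free.  Asking that a form [f] of
    degree [t] vanish to order [t] along the whole fibre of [o], and to order
    [t + 1] at one point of it, imposes
    [(r - 1) * 'C(t - 1 + n, n) + 'C(t + n, n)] linear conditions.  If [f] satisfies
    them, its norm to [B] has degree [r * t] and vanishes at [o] to order more than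
    [r * t]; so the norm is zero, and [f] vanishes on [X] because [S / I] is a
    domain.  Hence there are at least as many conditions as forms of degree [t].
    This is [hilbert_bound].  The norm is handled as the determinant of a matrix
    with entries in [B], which represents multiplication by [f] up to a denominator;
    integrality is replaced by the remark that the denominator of the powers of [f]
    does not grow.

    It remains to see that a smooth connected [X] has a prime ideal
    ([ideal_prime]).  Let [v] be a point of [X].  As all tangent spaces have the
    same dimension, there are [n.+1] polynomial vector fields that map the forms
    of [I] into [I] and that span the tangent space at [v]
    ([exists_tangential_frame]).  The polynomials all of whose iterated derivatives
    along these fields vanish at [v] form a prime ideal, since a derivation in
    characteristic zero cuts out a prime ideal inside a prime ideal
    ([dcore_prime]); it contains the forms of [I], and [n.+1] linear forms are
    algebraically independent modulo it ([germ_alg_indep]).  A comparison of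
    Hilbert functions ([prime_maximal_dim]) shows that no such prime contains
    another one; hence these primes are stable under tangential derivations, and
    each is determined by any one point of its zero locus
    ([unique_component]).  So the zero loci of these primes are pairwise disjoint;
    there are at most [d] of them, and connectedness leaves only one. *)

(** * Linear systems, ideals and derivations *)

Section LinearSystem.
Variables (k : fieldType) (A B : finType).

Lemma underdetermined_system (M : A -> B -> k) :
  (#|B| < #|A|)%N ->
  exists2 c : A -> k, (exists a, c a != 0) &
    forall b, \sum_a c a * M a b = 0.
Proof.
move=> ltBA.
pose MM := \matrix_(i < #|A|, j < #|B|) M (enum_val i) (enum_val j).
have : kermx MM != 0.
  by rewrite -mxrank_eq0 mxrank_ker -lt0n subn_gt0 (leq_ltn_trans (rank_leq_col _)).
case/matrix0Pn=> i [j nz].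
exists (fun a => kermx MM i (enum_rank a)).
  by exists (enum_val j); rewrite enum_valK.
move=> b; have := congr1 (fun X : 'M_(_, _) => X i (enum_rank b)) (mulmx_ker MM).
rewrite !mxE => e; rewrite -[RHS]e (reindex_onto enum_rank enum_val) /=; last first.
  by move=> ? _; rewrite enum_valK.
apply: eq_big => [a|a _]; first by rewrite enum_rankK eqxx.
by rewrite !mxE !enum_rankK.
Qed.

End LinearSystem.

Section Ideals.
Variable S : comNzRingType.
Implicit Types P Q : S -> Prop.

Definition is_ideal P :=
  [/\ P 0, forall a b, P a -> P b -> P (a + b) & forall a b, P b -> P (a * b)].

Definition is_prime P :=
  [/\ is_ideal P, ~ P 1 & forall a b, P (a * b) -> P a \/ P b].

Lemma ideal_sum P (T : Type) (r : seq T) (C : pred T) (F : T -> S) :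
  is_ideal P -> (forall i, C i -> P (F i)) -> P (\sum_(i <- r | C i) F i).
Proof. by case=> P0 PD _ PF; elim/big_rec: _ => // i x Ci; apply/PD/PF. Qed.

Lemma idealMr P a b : is_ideal P -> P a -> P (a * b).
Proof. by case=> _ _ PM Pa; rewrite mulrC; apply: PM. Qed.

Lemma idealN P a : is_ideal P -> P a -> P (- a).
Proof. by case=> _ _ PM Pa; rewrite -mulN1r; apply: PM. Qed.

Lemma idealB P a b : is_ideal P -> P a -> P b -> P (a - b).
Proof. by move=> iP Pa Pb; case: (iP) => _ PD _; apply: PD => //; apply: idealN. Qed.

Lemma idealX P a n : is_ideal P -> P a -> (0 < n)%N -> P (a ^+ n).
Proof. by move=> iP Pa; case: n => // n _; rewrite exprS; apply: idealMr. Qed.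

Lemma prime_cancel P a b : is_prime P -> ~ P a -> P (a * b) -> P b.
Proof. by case=> _ _ PM nPa /PM []. Qed.

Lemma prime_exp P a n : is_prime P -> P (a ^+ n) -> P a.
Proof.
by move=> pP; elim: n => [|n IHn]; case: (pP) => _ P1 PM; rewrite ?expr0 // exprS => /PM[].
Qed.

Lemma ideal_prod (T : finType) P (C : pred T) (F : T -> S) j :
  is_ideal P -> C j -> P (F j) -> P (\prod_(i | C i) F i).
Proof. by move=> iP Cj PFj; rewrite (bigD1 j) //=; apply: idealMr. Qed.

End Ideals.

Section DifferentialCore.
Variables (S : comNzRingType) (D : S -> S).
Hypotheses (DD : forall a b, D (a + b) = D a + D b)
           (DM : forall a b, D (a * b) = D a * b + a * D b).

Let D0 : D 0 = 0.
Proof. by apply: (addrI (D 0)); rewrite -DD !addr0. Qed.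

Lemma derivation_sum (T : Type) (r : seq T) (C : pred T) (F : T -> S) :
  D (\sum_(i <- r | C i) F i) = \sum_(i <- r | C i) D (F i).
Proof. by apply: (big_morph D). Qed.

Lemma iter_derivation_add r a b : iter r D (a + b) = iter r D a + iter r D b.
Proof. by elim: r => //= r ->. Qed.

Lemma leibniz r a b :
  iter r D (a * b) =
  \sum_(i < r.+1) (iter i D a * iter (r - i) D b) *+ 'C(r, i).
Proof.
elim: r => [|r IHr]; first by rewrite big_ord1.
rewrite iterS IHr derivation_sum.
have DMn x m : D (x *+ m) = D x *+ m.
  by elim: m => [|m IHm]; rewrite ?mulr0n ?D0 // !mulrS DD IHm.
under eq_bigr => i _ do rewrite DMn DM mulrnDl.
rewrite big_split /= [RHS]big_ord_recl /= bin0.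
under [X in _ = _ + X]eq_bigr => i _ do
  rewrite add0n /bump leq0n add1n subSS binS mulrnDr addrC.
rewrite big_split /= [RHS]addrCA; congr (_ + _).
rewrite [X in _ = _ + X]big_ord_recr /= bin_small // mulr0n addr0.
rewrite big_ord_recl /= bin0 subn0; congr (_ + _).
apply: eq_bigr => i _; rewrite /bump leq0n add1n add0n; congr (_ * _ *+ _).
by rewrite -iterS subnSK.
Qed.

(** The largest subset of [P] that is stable under [D]. *)
Definition dcore (P : S -> Prop) (a : S) := forall r, P (iter r D a).

Lemma dcore_sub P a : dcore P a -> P a.
Proof. by move/(_ 0%N). Qed.

Lemma dcore_stable P a : dcore P a -> dcore P (D a).
Proof. by move=> Pa r; rewrite -iterSr; apply: Pa. Qed.

(** If [D^i a] and [D^j b] are the first derivatives outside [P], then all but one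
    of the terms in the Leibniz formula for [D^(i + j) (a * b)] lie in [P], and the
    remaining one does not: this is where integers must be invertible. *)
Lemma dcore_prime P :
  (forall n a, P (a *+ n.+1) -> P a) -> is_prime P -> is_prime (dcore P).
Proof.
move=> Pn [iP P1 PM]; have [P0 PD PMl] := iP; split; first split.
- by move=> r; suff -> : iter r D 0 = 0 by []; elim: r => //= r ->.
- by move=> a b Pa Pb r; rewrite iter_derivation_add; apply: PD.
- move=> a b Pb r; rewrite leibniz; apply: ideal_sum => // i _.
  by rewrite -mulr_natl; apply: (PMl); apply: PMl.
- by move/dcore_sub.
move=> a b Pab; apply: contrapT => /not_orP[/existsNP[i0 nPa] /existsNP[j0 nPb]].
have exa : exists i, ~~ `[< P (iter i D a) >] by exists i0; apply/asboolPn.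
have exb : exists i, ~~ `[< P (iter i D b) >] by exists j0; apply/asboolPn.
case: (ex_minnP exa) => i /asboolPn nPi mini.
case: (ex_minnP exb) => j /asboolPn nPj minj.
have Pi l : (l < i)%N -> P (iter l D a).
  by move=> lt_li; apply: contrapT => /asboolPn /mini; rewrite leqNgt lt_li.
have Pj l : (l < j)%N -> P (iter l D b).
  by move=> lt_li; apply: contrapT => /asboolPn /minj; rewrite leqNgt lt_li.
have lt_i : (i < (i + j).+1)%N by rewrite ltnS leq_addr.
have := Pab (i + j)%N; rewrite leibniz (bigD1 (Ordinal lt_i)) //= addKn => Psum.
have Prest : P (\sum_(l < (i + j).+1 | l != Ordinal lt_i)
    (iter l D a * iter (i + j - l) D b) *+ 'C(i + j, l)).
  apply: ideal_sum => // l /eqP ne_l; rewrite -mulr_natl; apply: (PMl).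
  have [lt_li|] := ltnP l i; first by apply: idealMr => //; apply: Pi.
  rewrite leq_eqVlt => /orP[/eqP e|lt_il]; first by case: ne_l; apply: val_inj.
  by apply: (PMl); apply: Pj; rewrite ltn_subLR ?ltn_add2r // -ltnS.
have {Psum Prest}Pt := idealB iP Psum Prest; rewrite addrK in Pt.
move: Pt; have := bin_gt0 (i + j) i; rewrite leq_addr; case: 'C(_, _) => // n _.
by move/Pn/PM => [].
Qed.

End DifferentialCore.

(** * Multivariate polynomials *)

Notation "p \@ y" := (mmap (@mpolyC _ _) y p) (at level 40, no associativity).

Section RingInduction.
Variables (n : nat) (R : nzRingType).

(** Identities between ring morphisms or derivations need only be checked on
    constants and variables. *)
Lemma mpoly_ring_ind (P : {mpoly R[n]} -> Prop) :
    (forall c, P c%:MP) -> (forall i, P 'X_i) ->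
    (forall p q, P p -> P q -> P (p + q)) ->
    (forall p q, P p -> P q -> P (p * q)) ->
  forall p, P p.
Proof.
move=> PC PX PD PM p; rewrite [p]mpolyE.
have P1 : P 1 by rewrite -mpolyC1; apply: PC.
apply: (big_ind P) => [||m _]; [by rewrite -mpolyC0; apply: PC | exact: PD |].
rewrite -mul_mpolyC; apply: (PM) => //; rewrite mpolyXE_id.
apply: (big_ind P) => // i _; elim: (m i) => [|e IHe]; first by rewrite expr0.
by rewrite exprS; apply: PM.
Qed.

End RingInduction.

Section Calculus.

Lemma mmap_chain_rule n (R : comNzRingType) (S : comNzRingType)
    (f : {rmorphism R -> S}) (h : 'I_n -> S) (D : S -> S)
    (DD : forall a b, D (a + b) = D a + D b)
    (DM : forall a b, D (a * b) = D a * b + a * D b)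
    (DC : forall c, D (f c) = 0) (p : {mpoly R[n]}) :
  D (mmap f h p) = \sum_i mmap f h p^`M(i) * D (h i).
Proof.
elim/mpoly_ring_ind: p => [c|j|p q IHp IHq|p q IHp IHq].
- rewrite mmapC DC big1 // => i _.
  by rewrite mderivC mmap0 mul0r.
- rewrite mmapX mmap1U (bigD1 j) //= mderivX mnm1E eqxx.
  have -> : (U_(j) - U_(j) = 0 :> 'X_{1..n})%MM by apply/mnmP=> l; rewrite !mnmE subnn.
  rewrite scale1r mpolyX0 rmorph1 mul1r big1 ?addr0 // => i ne_ij.
  by rewrite mderivX mnm1E eq_sym (negPf ne_ij) scale0r mmap0 mul0r.
- rewrite raddfD DD IHp IHq -big_split /=; apply: eq_bigr => i _.
  by rewrite mderivD raddfD mulrDl.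
- rewrite rmorphM DM IHp IHq mulr_suml mulr_sumr -big_split /=.
  apply: eq_bigr => i _; rewrite mderivM raddfD /= !rmorphM mulrDl.
  by rewrite -!mulrA; congr (_ * _ + _); rewrite mulrC.
Qed.

Variable k : numFieldType.

Lemma poly_everywhere0 (p : {poly k}) : (forall x, p.[x] = 0) -> p = 0.
Proof.
move=> p0; apply: contraTeq isT => nz_p.
have := max_poly_roots (rs := [seq i%:R | i <- iota 0 (size p)]) nz_p.
rewrite size_map size_iota ltnn; apply.
  by apply/allP => x _; rewrite rootE p0.
rewrite map_inj_in_uniq ?iota_uniq // => i j _ _ /eqP.
by rewrite eqr_nat => /eqP.
Qed.

Variable n : nat.
Implicit Types (p : {mpoly k[n]}) (v : 'I_n -> k).

(** The derivative of [p] along its leading monomial is a nonzero constant. *)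
Lemma mpoly_taylor0 p v : (forall m, (p^`M[m]).@[v] = 0) -> p = 0.
Proof.
move=> p0; apply: contraTeq isT => nz_p.
suff e : p^`M[mlead p] = (p@_(mlead p) *+ \prod_(i < n) (mlead p i)`!)%:MP.
  have /eqP := p0 (mlead p); rewrite e mevalC mulrn_eq0 mleadc_eq0 (negPf nz_p).
  rewrite orbF => /eqP e0; suff : (0 < \prod_(i < n) (mlead p i)`!)%N by rewrite e0.
  by apply: prodn_gt0 => i; apply: fact_gt0.
have e0 : (mlead p + 0)%MM = mlead p by apply: addm0.
apply/mpolyP => m; rewrite mcoeff_mderivm mcoeffC; have [->|nz_m] := eqVneq m 0%MM.
  rewrite e0 mulr1; congr (_ *+ _); apply: eq_bigr => i _.
  by rewrite ffactnn.
rewrite mulr0 mcoeff_gt_mlead ?mul0rn //.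
have := ltmc_add2r (mlead p) 0%MM m; rewrite e0 => ->.
by rewrite Order.POrderTheory.lt_neqAle le0m eq_sym nz_m.
Qed.

Lemma mderiv_everywhere0 p i :
  (forall v, p.@[v] = 0) -> forall v, (p^`M(i)).@[v] = 0.
Proof.
move=> p0 v.
pose h j : {poly k} := (v j)%:P + 'X *+ (i == j).
have evh (q : {mpoly k[n]}) x :
    (mmap polyC h q).[x] = q.@[fun j => v j + x *+ (i == j)].
  elim/mpoly_ring_ind: q => [c|j|q r IHq IHr|q r IHq IHr].
  - by rewrite mmapC mevalC hornerC.
  - by rewrite mmapX mmap1U mevalXU hornerD hornerC hornerMn hornerX.
  - by rewrite mmapD mevalD hornerD IHq IHr.
  - by rewrite rmorphM mevalM hornerM IHq IHr.
have /(congr1 (fun q => q^`().[0])) : mmap polyC h p = 0.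
  by apply: poly_everywhere0 => x; rewrite evh p0.
rewrite (mmap_chain_rule h (@derivD _) (@derivM _) (@derivC _)) deriv0 horner0.
rewrite (bigD1 i) //= big1 => [|j ne_ji].
  rewrite addr0 hornerM evh /h derivD derivC add0r eqxx derivX hornerC mulr1 => <-.
  by apply: meval_eq => j; rewrite mul0rn addr0.
by rewrite /h derivD derivC eq_sym (negPf ne_ji) mulr0n deriv0 addr0 mulr0.
Qed.

(** All partial derivatives vanish everywhere too, so the Taylor expansion at the
    origin is zero. *)
Lemma mpoly_everywhere0 p : (forall v, p.@[v] = 0) -> p = 0.
Proof.
move=> p0; apply: (@mpoly_taylor0 _ (fun=> 0)) => m.
suff: forall v, (p^`M[m]).@[v] = 0 by [].
have pn0 i e q : (forall v, q.@[v] = 0) -> forall v, (q^`M(i, e)).@[v] = 0.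
  by move=> q0; elim: e => [|e IHe]; rewrite ?mderivn0 // mderivnS; apply: mderiv_everywhere0.
rewrite [m]multinomUE_id; elim: (index_enum _) p p0 => [|i s IHs] p p0.
  by rewrite big_nil mderivm0m.
by rewrite big_cons mderivmDm; apply: IHs; apply: pn0.
Qed.

Lemma mpoly_neq0_point p : p != 0 -> exists v, p.@[v] != 0.
Proof.
move=> nz_p; apply: contrapT => /forallNP p0; case/eqP: nz_p.
by apply: mpoly_everywhere0 => v; apply/eqP; case: eqP (p0 v) => // _ [].
Qed.

Lemma mpoly_ideal_mulrn (P : {mpoly k[n]} -> Prop) :
  is_ideal P -> forall e p, P (p *+ e.+1) -> P p.
Proof.
case=> _ _ PM e p /(PM (e.+1%:R^-1)%:MP).
rewrite mulrnAr -mulrnAl -mpolyCMn -[X in X%:MP]mulr_natr mulVf ?mpolyC1 ?mul1r //.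
by rewrite pnatr_eq0.
Qed.

End Calculus.

Section Homogeneous.
Variables (n : nat) (k : fieldType).
Implicit Types (p q : {mpoly k[n]}).

Lemma homogM e b p q :
  p \is e.-homog -> q \is b.-homog -> p * q \is (e + b).-homog.
Proof. exact: dhomogM. Qed.

Lemma homogD e p q : p \is e.-homog -> q \is e.-homog -> p + q \is e.-homog.
Proof. exact: rpredD. Qed.

Lemma homogB e p q : p \is e.-homog -> q \is e.-homog -> p - q \is e.-homog.
Proof. exact: rpredB. Qed.

Lemma homogZ e (c : k) p : p \is e.-homog -> c *: p \is e.-homog.
Proof. exact: dhomogZ. Qed.

Lemma homog_sum (T : Type) (r : seq T) (C : pred T) (F : T -> {mpoly k[n]}) e :
  (forall i, C i -> F i \is e.-homog) -> \sum_(i <- r | C i) F i \is e.-homog.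
Proof. exact: rpred_sum. Qed.

Lemma homogC (c : k) : c%:MP_[n] \is 0.-homog.
Proof. by rewrite -[c%:MP]mulr1 mul_mpolyC; apply/dhomogZ/dhomog1. Qed.

Lemma homog_var (i : 'I_n) : ('X_i : {mpoly k[n]}) \is 1.-homog.
Proof. by rewrite dhomogX /= mdeg1. Qed.

Lemma var_neq0 (i : 'I_n) : ('X_i : {mpoly k[n]}) != 0.
Proof. by rewrite -msize_poly_eq0 msizeX mdeg1. Qed.

Lemma homog_coef0 e p m : p \is e.-homog -> mdeg m != e -> p@_m = 0.
Proof. exact: dhomog_nemf_coeff. Qed.

Lemma homog_prod (T : Type) (r : seq T) (C : pred T) (F : T -> {mpoly k[n]}) e :
  (forall i, C i -> F i \is (e i).-homog) ->
  \prod_(i <- r | C i) F i \is (\sum_(i <- r | C i) e i)%N.-homog.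
Proof.
move=> hF; elim/big_rec2: _ => [|i x y Ci]; first exact: dhomog1.
by apply: dhomogM; apply: hF.
Qed.

Lemma homogXn e p m : p \is e.-homog -> p ^+ m \is (e * m).-homog.
Proof. exact: dhomogMn. Qed.

Lemma homog_det r e (M : 'M[{mpoly k[n]}]_r) :
  (forall i j, M i j \is e.-homog) -> \det M \is (r * e).-homog.
Proof.
move=> hM; apply: rpred_sum => s _.
have hP : \prod_i M i (s i) \is (r * e).-homog.
  have := homog_prod (index_enum 'I_r) (C := xpredT) (e := fun=> e)
            (fun i _ => hM i (s i)).
  by rewrite sum_nat_const card_ord.
by rewrite -signr_odd; case: odd; rewrite ?mulN1r ?mul1r ?rpredN.
Qed.

(** Homogeneous components allow one to replace arbitrary coefficients by
    homogeneous ones in linear relations between forms. *)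
Lemma pihomogM j e p q :
  q \is e.-homog -> pihomog mdeg (j + e) (p * q) = pihomog mdeg j p * q.
Proof.
move=> hq; elim/mpolyind: p => [|c m p _ _ IHp].
  by rewrite mul0r !pihomog0 mul0r.
rewrite mulrDl !pihomogD IHp mulrDl; congr (_ + _).
rewrite -scalerAl !linearZ -scalerAl; congr (_ *: _).
rewrite /= pihomogX; case: eqP => [ej|ne].
  by rewrite pihomog_dE // dhomogM // dhomogX ej.
rewrite mul0r; apply: (@pihomog_ne0 _ _ _ (mdeg m + e)%N).
  by rewrite eqn_add2r; apply/eqP.
by apply: dhomogM; rewrite ?dhomogX.
Qed.

Lemma homog_eval_scale D p (c : k) (v : 'I_n -> k) :
  p \is D.-homog -> p.@[fun i => c * v i] = c ^+ D * p.@[v].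
Proof.
move=> hp; rewrite !mevalE mulr_sumr big_seq [RHS]big_seq.
apply: eq_bigr => m /(dhomog_mf hp) dm; rewrite mulrCA; congr (_ * _).
rewrite -dm /= mdegE -prodrXr -big_split /=; apply: eq_bigr => i _.
by rewrite exprMn.
Qed.

Lemma homog0_const p : p \is 0.-homog -> p = (p@_0%MM)%:MP.
Proof.
move=> hp; apply/mpolyP => m; rewrite mcoeffC; have [->|nz] := eqVneq m 0%MM; first by rewrite mulr1.
by rewrite mulr0 (homog_coef0 hp) // mdeg_eq0.
Qed.

End Homogeneous.

Section Substitution.
Variables (q n : nat) (k : fieldType).
Implicit Types (p : {mpoly k[q]}) (y z : 'I_q -> {mpoly k[n]}).

Lemma subst_eval p y v : (p \@ y).@[v] = p.@[fun i => (y i).@[v]].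
Proof.
elim/mpoly_ring_ind: p => [c|j|p r IHp IHr|p r IHp IHr].
- by rewrite mmapC !mevalC.
- by rewrite mmapX mmap1U mevalXU.
- by rewrite mmapD !mevalD IHp IHr.
- by rewrite rmorphM !mevalM IHp IHr.
Qed.

Lemma subst_homog e s p y :
  (forall i, y i \is e.-homog) -> p \is s.-homog -> p \@ y \is (e * s).-homog.
Proof.
move=> hy hp; rewrite /mmap big_seq; apply: rpred_sum => m /(dhomog_mf hp) <-.
rewrite mul_mpolyC; apply: dhomogZ; rewrite /= mdegE big_distrr /=.
by apply: homog_prod => i _; apply: homogXn.
Qed.

Lemma subst_congr (P : {mpoly k[n]} -> Prop) y z p :
  is_ideal P -> (forall i, P (y i - z i)) -> P (p \@ y - p \@ z).
Proof.
move=> iP Pyz; have [P0 PD PM] := iP.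
elim/mpoly_ring_ind: p => [c|j|p r IHp IHr|p r IHp IHr].
- by rewrite !mmapC subrr.
- by rewrite !mmapX !mmap1U.
- by rewrite !mmapD opprD addrACA; apply: PD.
rewrite !rmorphM /=.
have -> : (p \@ y) * (r \@ y) - (p \@ z) * (r \@ z) =
  (p \@ y) * (r \@ y - r \@ z) + (r \@ z) * (p \@ y - p \@ z).
  by rewrite !mulrBr addrA [(r \@ z) * _]mulrC subrK [(r \@ z) * _]mulrC.
by apply: PD; apply: PM.
Qed.

End Substitution.

Section HomogeneousMonomials.
Variables (n d : nat).

(** Indexing the monomials of degree [d] by an ordinal gives coordinates to forms
    and makes the number of conditions on them a binomial coefficient. *)
Definition hmon (i : 'I_'C(d + n, d)) : 'X_{1..n.+1} :=
  nth 0%MM [seq s2m t | t : d.-tuple 'I_n.+1 <- enum (basis n.+1 d)] i.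

Lemma mdeg_hmon i : mdeg (hmon i) = d.
Proof. by apply/eqP; rewrite basis_cover mem_nth // size_basis. Qed.

Lemma hmon_inj : injective hmon.
Proof.
move=> i j /eqP; rewrite nth_uniq ?size_basis ?uniq_basis //.
by move=> /eqP/val_inj.
Qed.

Lemma hmon_surj m : mdeg m = d -> exists i, hmon i = m.
Proof.
move/eqP; rewrite basis_cover => sm.
have lt : (index m [seq s2m t | t : d.-tuple 'I_n.+1 <- enum (basis n.+1 d)] < 'C(d + n, d))%N.
  by rewrite -(size_basis n d) index_mem.
by exists (Ordinal lt); rewrite /hmon nth_index.
Qed.

Lemma homog_hmonE (k : fieldType) (p : {mpoly k[n.+1]}) :
  p \is d.-homog -> p = \sum_i p@_(hmon i) *: 'X_[hmon i].
Proof.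
move=> hp; apply/mpolyP => m; rewrite raddf_sum /=.
have [/hmon_surj[i <-]|ne] := eqVneq (mdeg m) d.
  rewrite (bigD1 i) //= mcoeffZ mcoeffX eqxx mulr1 big1 ?addr0 // => j ne_ji.
  by rewrite mcoeffZ mcoeffX (inj_eq hmon_inj) (negPf ne_ji) mulr0.
rewrite (homog_coef0 hp) // big1 // => i _.
rewrite mcoeffZ mcoeffX; case: eqP => [e|]; last by rewrite mulr0.
by rewrite -e mdeg_hmon eqxx in ne.
Qed.

Lemma dim_homog (k : fieldType) : \dim {: dhomog n.+1 k d} = 'C(d + n, d).
Proof. by rewrite dimvf. Qed.

End HomogeneousMonomials.

(** * Hilbert functions *)

Section DimensionCount.
Variables (k : fieldType) (V W : vectType k) (f : V -> W) (J : {vspace W}).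
Hypothesis f_linear : linear f.

Let fL : {linear V -> W} := HB.pack f (GRing.isLinear.Build k V W *:%R f f_linear).

Lemma dim_injective_modulo :
  (forall v, f v \in J -> v = 0) -> (\dim {:V} + \dim J <= \dim {:W})%N.
Proof.
move=> inj_f; pose g := linfun fL.
have gE v : g v = f v by rewrite lfunE.
have kg : lker g = 0%VS.
  apply/eqP; rewrite -subv0; apply/subvP => v; rewrite memv_ker gE => /eqP fv0.
  by rewrite (inj_f v) ?mem0v // fv0 mem0v.
have gJ : (g @: fullv :&: J = 0)%VS.
  apply/eqP; rewrite -subv0; apply/subvP => w /memv_capP[/memv_imgP[v _ ->]].
  by rewrite gE => /inj_f ->; rewrite -gE linear0 mem0v.
rewrite -(@limg_dim_eq _ _ _ g) ?kg ?capv0 // -dimv_disjoint_sum //.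
exact/dimvS/subvf.
Qed.

Lemma dim_surjective_modulo :
  (forall w, exists v, w - f v \in J) -> (\dim {:W} <= \dim {:V} + \dim J)%N.
Proof.
move=> surj_f; pose g := linfun fL.
have gE v : g v = f v by rewrite lfunE.
suff /eqP <- : (g @: fullv + J == fullv)%VS.
  apply: leq_trans (dimv_add_leqif _ _) _; rewrite leq_add2r.
  by rewrite -(limg_ker_dim g fullv) leq_addl.
rewrite eqEsubv subvf; apply/subvP => w _; have [v wv] := surj_f w.
rewrite -[w](subrK (f v)) addrC memv_add // -gE memv_img ?memvf //.
Qed.

End DimensionCount.

Lemma dimvf_ffun (k : fieldType) (V : vectType k) (T : finType) :
  \dim {: {ffun T -> V}} = (#|T| * \dim {:V})%N.
Proof. by rewrite !dimvf. Qed.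

(** Stated for an arbitrary set of polynomials, so that it also applies to prime
    ideals which have the same forms as the ideal of a variety. *)
Definition hilbert_degree (k : fieldType) N (I : {mpoly k[N.+1]} -> Prop) n d :=
  exists2 P : {poly rat},
    exists t0 : nat, forall t, (t0 <= t)%N ->
      exists2 J : {vspace dhomog N.+1 k t}, (forall p : dhomog N.+1 k t, p \in J <-> I p) &
        P.[t%:R] = (\dim {:dhomog N.+1 k t})%:R - (\dim J)%:R
    & (size (P - (d%:R / (n`!)%:R) *: 'X^n)%R <= n)%N.

(** Homogeneous relations suffice, since only relations between forms of equal
    degrees are met below. *)
Definition alg_indep (k : fieldType) N (I : {mpoly k[N]} -> Prop) q (x : 'I_q -> {mpoly k[N]}) :=
  forall s (p : {mpoly k[q]}), p \is s.-homog -> I (p \@ x) -> p = 0.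

(** The multiples [u i * k[x i]] form a direct sum modulo [I]; each summand may
    have its own polynomial ring [k[x i]]. *)
Definition free_family (k : fieldType) N (I : {mpoly k[N]} -> Prop) K q
    (u : 'I_K -> {mpoly k[N]}) (x : 'I_K -> 'I_q -> {mpoly k[N]}) :=
  forall s (p : 'I_K -> {mpoly k[q]}), (forall i, p i \is s.-homog) ->
    I (\sum_i u i * (p i \@ x i)) -> forall i, p i = 0.

(** Both sides are polynomials in [s] of degree at most [n]; the coefficients of
    [s^n] are [K / n!] and [d / n!]. *)
Lemma binomial_growth_le (P : {poly rat}) K n d E t0 :
    (size (P - (d%:R / (n`!)%:R) *: 'X^n)%R <= n)%N ->
    (forall s, (t0 <= s)%N -> (K * 'C(s + n, s))%:R <= P.[(E + s)%:R]) ->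
  (K <= d)%N.
Proof.
set a : rat := d%:R / n`!%:R; set Q := P - _ => szQ leP.
rewrite leqNgt; apply/negP => lt_dK.
have fact_n0 : n`!%:R != 0 :> rat by rewrite pnatr_eq0 -lt0n fact_gt0.
pose A1 : {poly rat} := \prod_(i < n) ('X + ((n - i)%:R)%:P).
pose A2 : {poly rat} := ('X + (E%:R)%:P) ^+ n.
have szXC (c : rat) : size ('X + c%:P) = 2%N by rewrite size_XaddC.
have monA1 : A1 \is monic by apply: monic_prod => i _; apply: monicXaddC.
have monA2 : A2 \is monic by apply: monic_exp; apply: monicXaddC.
have szA1 : size A1 = n.+1.
  rewrite size_prod => [|i _]; last by rewrite -size_poly_eq0 szXC.
  by under eq_bigr => i _ do rewrite szXC; rewrite sum_nat_const card_ord muln2 -addnn subSn ?leq_addr // addnK.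
have szA2 : size A2 = n.+1.
  by rewrite size_exp_XaddC || (rewrite my_size_exp -?size_poly_eq0 szXC // mul1n).
pose H := (K%:R / n`!%:R) *: A1 - (a *: A2 + (Q \Po ('X + (E%:R)%:P))).
have Hle s : (t0 <= s)%N -> H.[s%:R] <= 0.
  move=> /leP lePs; rewrite /H hornerD hornerN subr_le0.
  suff -> : (a *: A2 + (Q \Po ('X + (E%:R)%:P))).[s%:R] = P.[(E + s)%:R].
    suff -> : ((K%:R / n`!%:R) *: A1).[s%:R] = (K * 'C(s + n, s))%:R by [].
    rewrite hornerZ /A1 horner_prod natrM.
    have e : 'C(s + n, s)%:R * n`!%:R = ((s + n) ^_ n)%:R :> rat.
      by rewrite -natrM -bin_ffact -(bin_sub (leq_addl s n)) addnK.
    rewrite -mulrA; congr (_ * _); apply: (mulfI fact_n0); rewrite mulVKf // mulrC e.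
    rewrite ffact_prod natr_prod; apply: eq_bigr => i _.
    by rewrite hornerD hornerX hornerC -natrD addnBA // ltnW.
  have -> : P = a *: 'X^n + Q by rewrite /Q addrC subrK.
  rewrite !hornerD !hornerZ horner_comp /A2 horner_exp !hornerE addrC.
  by rewrite natrD [E%:R + _]addrC.
have nH : H`_n = (K%:R - d%:R) / n`!%:R.
  have c1 : A1`_n = 1 by have /monicP := monA1; rewrite lead_coefE szA1.
  have c2 : A2`_n = 1 by have /monicP := monA2; rewrite lead_coefE szA2.
  rewrite /H coefB coefD !coefZ c1 c2 !mulr1 [(_ \Po _)`_n]nth_default ?addr0 ?mulrBl //.
  by rewrite size_comp_poly2 ?szXC.
have H_gt0 : 0 < H`_n.
  by rewrite nH divr_gt0 ?ltr0n ?fact_gt0 // subr_gt0 ltr_nat.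
have szH : size H = n.+1.
  apply/eqP; rewrite eqn_leq; apply/andP; split.
    rewrite (leq_trans (size_polyD _ _)) // size_polyN geq_max.
    rewrite (leq_trans (size_scale_leq _ _)) ?szA1 //=.
    rewrite (leq_trans (size_polyD _ _)) // geq_max.
    rewrite (leq_trans (size_scale_leq _ _)) ?szA2 //=.
    by rewrite size_comp_poly2 ?szXC // leqW.
  by rewrite ltnNge; apply: contraTN H_gt0 => /leq_sizeP/(_ n (leqnn n)) ->; rewrite ltxx.
have [|M HM] := @poly_pinfty_gt_lc _ H; first by rewrite lead_coefE szH.
have [m Mm] : exists m : nat, M <= m%:R.
  exists (Num.bound `|M|); apply/ltW/(le_lt_trans (ler_norm M)).
  by apply: archi_boundP; apply: normr_ge0.
have := HM (maxn m t0)%:R; rewrite (le_trans Mm) ?ler_nat ?leq_maxl // => /(_ isT).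
by rewrite lead_coefE szH leNgt (le_lt_trans (Hle _ (leq_maxr _ _))).
Qed.

Section HilbertFunction.
Variables (k : fieldType) (N n d : nat) (I : {mpoly k[N.+1]} -> Prop).
Hypothesis I_ideal : is_ideal I.
Hypothesis I_deg : hilbert_degree I n d.

Section Combination.
Variables (E K q : nat) (u : 'I_K -> {mpoly k[N.+1]}) (x : 'I_K -> 'I_q -> {mpoly k[N.+1]}).
Hypothesis u_homog : forall i, u i \is E.-homog.
Hypothesis x_homog : forall i j, x i j \is 1.-homog.

Fact comb_homog s (p : {ffun 'I_K -> dhomog q k s}) :
  \sum_i u i * (mpoly_of_dhomog (p i) \@ x i) \is (E + s).-homog.
Proof.
apply: rpred_sum => i _; apply: homogM => //.
by have := subst_homog (x_homog i) (dhomog_is_dhomog (p i)); rewrite mul1n.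
Qed.

Definition comb s (p : {ffun 'I_K -> dhomog q k s}) : dhomog N.+1 k (E + s) :=
  DHomog (comb_homog p).

Fact comb_linear s : linear (@comb s).
Proof.
move=> c p r; apply: val_inj; rewrite /= scaler_sumr -big_split /=.
apply: eq_bigr => i _; rewrite !ffunE /= mmapD mmapZ.
by rewrite mulrDr mul_mpolyC scalerAr.
Qed.
End Combination.

Lemma free_family_count E K (u : 'I_K -> {mpoly k[N.+1]}) x :
    (forall i, u i \is E.-homog) -> (forall i j, x i j \is 1.-homog) ->
    free_family I u (x : 'I_K -> 'I_n.+1 -> _) ->
  exists t0, forall s, (t0 <= s)%N ->
  exists2 J : {vspace dhomog N.+1 k (E + s)}, (forall p : dhomog N.+1 k (E + s), p \in J <-> I p) &
    (K * 'C(s + n, s) + \dim J <= \dim {:dhomog N.+1 k (E + s)})%N.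
Proof.
move=> hu hx freeu; have [P [t0 hP] _] := I_deg; exists t0 => s le_s.
have [|J JE _] := hP (E + s)%N; first by rewrite (leq_trans le_s) ?leq_addl.
exists J => //; rewrite -{1}[K]card_ord -(dim_homog _ _ k) -dimvf_ffun.
apply: (dim_injective_modulo (comb_linear hu hx (s := s))) => p /JE /= Ip.
apply/ffunP => i; apply: val_inj; rewrite ffunE /=.
by apply: (freeu s (fun i => mpoly_of_dhomog (p i))) Ip i => j; apply: dhomog_is_dhomog.
Qed.

(** [K] independent copies of a polynomial ring in [n.+1] variables contribute
    [K / n! * t^n] to a Hilbert function whose leading term is [d / n! * t^n]. *)
Lemma free_family_le_degree E K (u : 'I_K -> {mpoly k[N.+1]}) (x : 'I_K -> 'I_n.+1 -> {mpoly k[N.+1]}) :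
    (forall i, u i \is E.-homog) -> (forall i j, x i j \is 1.-homog) ->
  free_family I u x -> (K <= d)%N.
Proof.
move=> hu hx freeu; have [P [t0 hP] szP] := I_deg.
have [t1 hu1] := free_family_count hu hx freeu.
apply: (binomial_growth_le (E := E) (t0 := maxn t0 t1) szP) => s.
rewrite geq_max => /andP[le0 le1].
have [J JE ->] := hP (E + s)%N (leq_trans le0 (leq_addl _ _)).
have [J' J'E leJ'] := hu1 s le1.
have -> : J = J' by apply/vspaceP => p; apply/idP/idP => [/JE/J'E|/J'E/JE].
by rewrite -natrB ?ler_nat ?leq_subRL ?(leq_trans _ leJ') ?leq_addl // addnC.
Qed.

End HilbertFunction.

(** * Primes of maximal dimension *)

Definition form_sub (k : fieldType) N (J Q : {mpoly k[N]} -> Prop) :=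
  forall e (f : {mpoly k[N]}), f \is e.-homog -> J f -> Q f.

Section AlgebraicIndependence.
Variables (k : numFieldType) (N n d : nat) (I : {mpoly k[N.+1]} -> Prop).
Hypothesis I_deg : hilbert_degree I n d.
Implicit Types (J Q : {mpoly k[N.+1]} -> Prop).

(** If [f] were in [Q] but not in [J], then [1, f, f^2, ...] would be linearly
    independent modulo [J] over the polynomial ring [k[x]]: in a relation, the
    coefficient of the lowest power of [f] lies in [Q] and is therefore zero.  With
    [d.+1] powers this contradicts the growth of the Hilbert function.  Factors
    [x ord0] bring the powers of [f] to the same degree. *)
Lemma prime_maximal_dim J Q (x : 'I_n.+1 -> {mpoly k[N.+1]}) :
    is_prime J -> is_ideal Q -> form_sub I J -> form_sub J Q ->
    (forall i, x i \is 1.-homog) -> alg_indep Q x ->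
  form_sub Q J.
Proof.
move=> pJ iQ IJ JQ hx indx e f hf Qf; apply: contrapT => nJf.
have [_ QD QM] := iQ; have [iJ _ _] := pJ.
pose u (b : 'I_d.+1) := f ^+ b * x ord0 ^+ (e * (d - b)).
have hu b : u b \is (e * d).-homog.
  have := homogM (homogXn b hf) (homogXn (e * (d - b)) (hx ord0)).
  by rewrite mul1n -mulnDr subnKC // -ltnS.
suff /(free_family_le_degree I_deg hu (fun=> hx)) : free_family I u (fun=> x).
  by rewrite ltnn.
move=> s p hp Isum.
have hpx b : p b \@ x \is s.-homog by have := subst_homog hx (hp b); rewrite mul1n.
have {Isum} : J (\sum_b u b * (p b \@ x)).
  apply: (IJ (e * d + s)%N) => //; apply: rpred_sum => b _.
  exact: homogM (hu b) (hpx b).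
move=> Jsum b; have [m] := ubnP (b : nat).
elim: m => // m IHm in b *; rewrite ltnS => le_bm.
have p0 (c : 'I_d.+1) : (c < b)%N -> p c = 0.
  by move=> lt_cb; apply: IHm; apply: leq_trans le_bm.
pose R := \sum_(c : 'I_d.+1 | (b <= c)%N)
  f ^+ (c - b) * (x ord0 ^+ (e * (d - c)) * (p c \@ x)).
have JR : J R.
  apply: (@prime_cancel _ _ (f ^+ b) _ pJ) => [/(prime_exp pJ)//|].
  rewrite mulr_sumr; move: Jsum; rewrite (bigID (fun c : 'I_d.+1 => (b <= c)%N)) /=.
  rewrite [X in _ + X]big1 => [|c]; last first.
    by rewrite -ltnNge => /p0 ->; rewrite mmap0 mulr0.
  rewrite addr0; congr (J _); apply: eq_bigr => c le_bc.
  by rewrite /u -{1}(subnKC le_bc) exprD !mulrA.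
have QR : Q R.
  apply: (JQ (e * (d - b) + s)%N) => //; apply: rpred_sum => c le_bc; rewrite mulrA.
  apply: homogM => //; have := homogM (homogXn (c - b) hf) (homogXn (e * (d - c)) (hx ord0)).
  by rewrite mul1n -mulnDr addnC addnBA // subnK // -ltnS.
have : Q (('X_ord0 ^+ (e * (d - b)) * p b) \@ x).
  rewrite rmorphM rmorphXn /= mmapX mmap1U.
  suff Qrest : Q (\sum_(c : 'I_d.+1 | (b <= c)%N && (c != b))
      f ^+ (c - b) * (x ord0 ^+ (e * (d - c)) * (p c \@ x))).
    have := idealB iQ QR Qrest; rewrite /R (bigD1 b) //= addrK.
    by rewrite subnn expr0 mul1r.
  apply: ideal_sum => // c /andP[le_bc ne_cb]; apply: idealMr => //.
  by apply: idealX => //; rewrite subn_gt0 ltn_neqAle eq_sym ne_cb.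
have hq : 'X_ord0 ^+ (e * (d - b)) * p b \is (1 * (e * (d - b)) + s).-homog.
  by apply: homogM => //; apply: homogXn; apply: homog_var.
move/(indx _ _ hq)/eqP; rewrite mulf_eq0 expf_eq0.
by rewrite (negPf (var_neq0 _ _)) andbF => /eqP.
Qed.

End AlgebraicIndependence.

(** * Gradients and tangent spaces *)

Section DirectionalDerivative.
Variables (n : nat) (k : fieldType).
Implicit Types (p q : {mpoly k[n]}).

Lemma homog_deriv e p i : p \is e.-homog -> p^`M(i) \is e.-1.-homog.
Proof.
move=> hp; apply/dhomogP => m /=; rewrite mcoeff_msupp mcoeff_deriv => nz.
have : m \in msupp p^`M(i) by rewrite mcoeff_msupp mcoeff_deriv.
have [/(dhomog_mf hp) /= <- _|] := boolP ((m + U_(i))%MM \in msupp p).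
  by rewrite mdegD mdeg1 addn1.
by move/memN_msupp_eq0 => e0; rewrite e0 mul0rn eqxx in nz.
Qed.

Definition vfield (a : 'I_n -> {mpoly k[n]}) p := \sum_i p^`M(i) * a i.

Lemma vfieldD a p q : vfield a (p + q) = vfield a p + vfield a q.
Proof. by rewrite -big_split /=; apply: eq_bigr => i _; rewrite mderivD mulrDl. Qed.

Lemma vfieldM a p q : vfield a (p * q) = vfield a p * q + p * vfield a q.
Proof.
rewrite mulr_suml mulr_sumr -big_split /=; apply: eq_bigr => i _.
by rewrite mderivM mulrDl -!mulrA [q * a i]mulrC.
Qed.

Lemma vfieldC a c : vfield a c%:MP = 0.
Proof. by rewrite /vfield big1 // => i _; rewrite mderivC mul0r. Qed.

Lemma vfield_linear a (c : 'I_n -> k) :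
  vfield a (\sum_i c i *: 'X_i) = \sum_i c i *: a i.
Proof.
apply: eq_bigr => i _; rewrite raddf_sum (bigD1 i) //= mderivZ mderivX mnm1E eqxx.
have -> : (U_(i) - U_(i) = 0 :> 'X_{1..n})%MM by apply/mnmP=> l; rewrite !mnmE subnn.
rewrite scale1r mpolyX0 big1 ?addr0 -?scalerAl ?mul1r // => j ne_ji.
by rewrite mderivZ mderivX mnm1E (negPf ne_ji) scale0r scaler0.
Qed.

Lemma vfield_homog e e' a p :
  (forall i, a i \is e'.-homog) -> p \is e.-homog -> vfield a p \is (e.-1 + e').-homog.
Proof.
by move=> ha hp; apply: rpred_sum => i _; apply: homogM => //; apply: homog_deriv.
Qed.

Definition gradient (v : 'rV[k]_n) p : 'rV[k]_n := \row_i (p^`M(i)).@[v 0].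

Lemma gradient_mul (v : 'rV[k]_n) p q : p.@[v 0] = 0 -> gradient v (q * p) = q.@[v 0] *: gradient v p.
Proof.
by move=> p0; apply/rowP => i; rewrite !mxE mderivM mevalD !mevalM p0 mulr0 add0r.
Qed.

Lemma vfield_eval (v : 'rV[k]_n) a p (b : 'cV[k]_n) :
  (forall i, (a i).@[v 0] = b i 0) -> (vfield a p).@[v 0] = (gradient v p *m b) 0 0.
Proof.
move=> ab; rewrite raddf_sum /= !mxE; apply: eq_bigr => i _.
by rewrite mevalM ab !mxE.
Qed.

End DirectionalDerivative.

Lemma row_free_sub_rank (k : fieldType) m p q (M : 'M[k]_(p, q)) :
  \rank M = m -> exists2 A : 'M[k]_(m, q), row_free A & (A <= M)%MS.
Proof. by move=> <-; exists (row_base M); rewrite ?row_base_free ?eq_row_base. Qed.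

Lemma vspace_rV_matrix (k : fieldType) q (T : {vspace 'rV[k]_q}) :
  exists2 B : 'M[k]_(\dim T, q), row_free B & forall w : 'rV_q, (w <= B)%MS = (w \in T).
Proof.
exists (\matrix_i (vbasis T)`_i).
  apply: inj_row_free => w; rewrite mulmx_sum_row => e.
  have /freeP/(_ (fun i => w 0 i)) := basis_free (vbasisP T).
  rewrite -[RHS]e => f0; apply/rowP => i; rewrite mxE; apply: f0.
  by apply: eq_bigr => j _; rewrite rowK.
move=> w; apply/submxP/idP => [[D ->]|wT].
  rewrite mulmx_sum_row; apply: memv_suml => i _; rewrite rowK memvZ //.
  by apply: vbasis_mem; rewrite mem_nth // size_tuple.
exists (\row_i coord (vbasis T) i w); rewrite {1}(coord_vbasis wT) mulmx_sum_row.
by apply: eq_bigr => i _; rewrite rowK mxE.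
Qed.

Definition vanishing (k : fieldType) N (X : 'rV[k]_N -> Prop) (p : {mpoly k[N]}) :=
  forall v, X v -> p.@[v 0] = 0.

Lemma vanishing_ideal (k : fieldType) N (X : 'rV[k]_N -> Prop) : is_ideal (vanishing X).
Proof.
split=> [v _|p q Ip Iq v Xv|p q Iq v Xv]; first exact: meval0.
  by rewrite mevalD Ip ?Iq ?addr0.
by rewrite mevalM Iq ?mulr0.
Qed.

Definition smooth_pure_dim (k : fieldType) N (X : 'rV[k]_N.+1 -> Prop) n :=
  forall v, X v -> exists2 T : {vspace 'rV[k]_N.+1},
    (forall w, w \in T <->
       forall t (p : dhomog N.+1 k t), vanishing X p ->
         \sum_(i < N.+1) ((p : {mpoly k[N.+1]})^`M(i)).@[v 0] * w 0 i = 0) &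
    \dim T = n.+1.

Section SmoothPoint.
Variables (k : fieldType) (N n : nat) (X : 'rV[k]_N.+1 -> Prop).
Notation I := (vanishing X).
Hypothesis X_nz : forall v, X v -> v != 0.
Hypothesis X_smooth : smooth_pure_dim X n.

Definition is_form_of (p : {mpoly k[N.+1]}) := (exists e, p \is e.-homog) /\ I p.

Lemma tangent_matrix v : X v ->
  exists2 B : 'M[k]_(n.+1, N.+1), row_free B &
    forall w : 'rV_N.+1, (w <= B)%MS <-> forall p, is_form_of p -> gradient v p *m w^T = 0.
Proof.
move=> /X_smooth[T TE dT]; rewrite -dT.
have [B Bfree BT] := vspace_rV_matrix T; exists B => // w; rewrite BT TE.
split=> [h p [[e hp] Ip]|h e p Ip].
  apply/matrixP => i j; rewrite !ord1 !mxE -[RHS](h e (DHomog hp) Ip).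
  by apply: eq_bigr => l _; rewrite !mxE.
have /matrixP/(_ 0 0) : gradient v p *m w^T = 0.
  by apply: h; split=> //; exists e; apply: dhomog_is_dhomog.
by rewrite !mxE => e0; rewrite -[RHS]e0; apply: eq_bigr => l _; rewrite !mxE.
Qed.

Lemma dim_le_ambient : (exists v, X v) -> (n <= N)%N.
Proof.
case=> v /X_smooth[T _ dT]; have := dimvS (subvf T).
by rewrite dT dimvf dim_matrix (mul1r N.+1) ltnS.
Qed.

Definition gradient_mx r (v : 'rV[k]_N.+1) (f : 'I_r -> {mpoly k[N.+1]}) : 'M[k]_(r, N.+1) :=
  \matrix_i gradient v (f i).

(** Gradients of forms of [I] annihilate the tangent space, of dimension [n.+1]. *)
Lemma gradient_rank_le r v (f : 'I_r -> {mpoly k[N.+1]}) :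
  X v -> (forall i, is_form_of (f i)) -> (\rank (gradient_mx v f) <= N - n)%N.
Proof.
move=> Xv hf; have [B Bfree BE] := tangent_matrix Xv.
have /mulmx0_rank_max : gradient_mx v f *m B^T = 0.
  apply/row_matrixP => i; rewrite row_mul rowK row0.
  apply/matrixP => a j; have /BE/(_ _ (hf i))/matrixP/(_ a 0) : (row j B <= B)%MS.
    exact: row_sub.
  by rewrite !mxE => e; rewrite -[RHS]e; apply: eq_bigr => l _; rewrite !mxE.
rewrite mxrank_tr (eqP Bfree) addnS ltnS => le_rN.
by rewrite leq_subRL ?(leq_trans _ le_rN) ?leq_addl // addnC.
Qed.

(** In a maximal independent family of gradients every other gradient is a
    combination of them, so the kernel of the family is the whole tangent space. *)
Lemma independent_gradients v : X v ->
  exists2 f : 'I_(N - n) -> {mpoly k[N.+1]},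
    (forall i, is_form_of (f i)) & row_free (gradient_mx v f).
Proof.
move=> Xv.
pose Q r := exists2 f : 'I_r -> {mpoly k[N.+1]},
  (forall i, is_form_of (f i)) & row_free (gradient_mx v f).
have exQ : exists r, `[< Q r >].
  exists 0; apply/asboolP; exists (fun=> 0) => [[]//|].
  by rewrite /row_free mxrank_eq0 flatmx0 eqxx.
have ubQ r : `[< Q r >] -> (r <= N - n)%N.
  by move/asboolP => [f hf /eqP <-]; apply: gradient_rank_le.
case: (ex_maxnP exQ ubQ) => r /asboolP[f hf ff] maxr.
suff {ubQ exQ} /eqP er : r == (N - n)%N by rewrite er in f hf ff; exists f.
rewrite eqn_leq -{1}(eqP ff) gradient_rank_le //=.
pose G := gradient_mx v f.
have inG p : is_form_of p -> (gradient v p <= G)%MS.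
  move=> hp; apply/negPn/negP => nGp.
  suff /asboolP/maxr : Q (r + 1)%N by rewrite addn1 ltnn.
  exists (fun i => match split i with inl j => f j | inr _ => p end).
    by move=> i; case: split.
  have -> : gradient_mx v (fun i => match split i with inl j => f j | inr _ => p end)
      = col_mx G (gradient v p).
    apply/row_matrixP => i; rewrite rowK; case: (split_ordP i) => j -> .
      by rewrite rowKu rowK.
    by rewrite rowKd ord1 row_id.
  have : (G < col_mx G (gradient v p))%MS.
    by rewrite /ltmx -!addsmxE addsmxSl addsmx_sub submx_refl.
  move/rank_ltmx; rewrite (eqP ff) /row_free eqn_leq rank_leq_row /= => lt_r.
  by apply: leq_trans lt_r; rewrite addn1.
have [B Bfree BE] := tangent_matrix Xv.
have : (kermx G^T <= B)%MS.
  apply/row_subP => i; apply/BE => p hp.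
  have /submxP[D ->] := inG p hp.
  rewrite -mulmxA; suff -> : G *m (row i (kermx G^T))^T = 0 by rewrite mulmx0.
  by apply: trmx_inj; rewrite trmx_mul trmxK trmx0 -row_mul mulmx_ker row0.
move/mxrankS; rewrite mxrank_ker mxrank_tr (eqP ff) (eqP Bfree).
by rewrite !leq_subLR addnS ltnS addnC.
Qed.

(** Multiplying by powers of a coordinate that does not vanish at [v] rescales the
    gradients at [v], the forms themselves being zero there.  Equal degrees make
    the vector fields below homogeneous. *)
Lemma independent_gradients_same_degree v : X v ->
  exists (e : nat) (f : 'I_(N - n) -> {mpoly k[N.+1]}),
    [/\ forall i, f i \is e.-homog, forall i, I (f i) & row_free (gradient_mx v f)].
Proof.
move=> Xv; have [f hf ff] := independent_gradients Xv.
have /choice[e he] : forall i, exists e, f i \is e.-homog by move=> i; case: (hf i).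
have /rV0Pn[l nz_vl] := X_nz Xv.
pose E := \max_i e i.
pose c i : {mpoly k[N.+1]} := 'X_l ^+ (E - e i).
exists E, (fun i => c i * f i); split=> [i|i|].
- rewrite -(@subnK (e i) E); last exact: leq_bigmax.
  by apply: homogM => //; have := homogXn (E - e i) (homog_var k l); rewrite mul1n.
- by have [_ PD PM] := vanishing_ideal X; apply: PM; case: (hf i).
pose d := \row_i (c i).@[v 0].
have -> : gradient_mx v (fun i => c i * f i) = diag_mx d *m gradient_mx v f.
  apply/row_matrixP => i; rewrite row_mul row_diag_mx -scalemxAl -rowE !rowK mxE.
  by rewrite gradient_mul //; case: (hf i) => _; apply.
rewrite /row_free mxrankMfree // -/(row_free _) row_free_unit unitmxE det_diag.
rewrite unitfE; apply/prodf_neq0 => i _; rewrite mxE rmorphXn /= mevalXU.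
exact: expf_neq0.
Qed.

End SmoothPoint.

(** * Vector fields tangent to a smooth variety *)

(** The linear forms [x] play the part of local coordinates at [v], and [D i] is
    the partial derivative along [x i], up to the factor [Delta]. *)
Definition tangential_frame (k : fieldType) N (I : {mpoly k[N]} -> Prop) n
    (v : 'rV[k]_N) (D : 'I_n -> {mpoly k[N]} -> {mpoly k[N]}) (x : 'I_n -> {mpoly k[N]})
    (Delta : {mpoly k[N]}) :=
  [/\ forall i, exists a, D i = vfield a,
      forall i e p, p \is e.-homog -> exists e', D i p \is e'.-homog,
      forall i e p, p \is e.-homog -> I p -> I (D i p),
      forall i, x i \is 1.-homog &
      (forall i j, D i (x j) = Delta *+ (i == j)) /\ Delta.@[v 0] != 0].

Section TangentialFrame.
Variables (k : fieldType) (N n : nat) (X : 'rV[k]_N.+1 -> Prop).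
Notation I := (vanishing X).
Hypothesis X_nz : forall v, X v -> v != 0.
Hypothesis X_smooth : smooth_pure_dim X n.

Notation toS := (map_mx (@mpolyC N.+1 k)).
Notation ev w := (map_mx (meval ((w : 'rV[k]_N.+1) 0))).

Lemma ev_const m q (w : 'rV[k]_N.+1) (A : 'M[k]_(m, q)) : ev w (toS A) = A.
Proof. by apply/matrixP => i j; rewrite !mxE mevalC. Qed.

(** Let [J] be the Jacobian matrix of [N - n] forms of [I] with independent
    gradients at [v], [C] a constant right inverse of [J] at [v], and
    [Delta = \det (J C)].  For a constant vector [c] the polynomial vector
    [Delta c - C (adj (J C)) J c] is killed by [J].  Where [Delta] is nonzero on
    [X], the rows of [J] span all gradients of forms of [I], so that derivatives of
    these forms along the field vanish; multiplication by [Delta] takes care of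
    the other points.  The coordinates are the linear forms that kill the columns
    of [C], and the vectors [c] are dual to them. *)
Lemma exists_tangential_frame v : X v -> exists D x Delta, @tangential_frame k N.+1 I n.+1 v D x Delta.
Proof.
move=> Xv; have le_nN := dim_le_ambient X_smooth (ex_intro _ v Xv).
have [e [f [hf If ff]]] := independent_gradients_same_degree X_nz X_smooth Xv.
set r := (N - n)%N in f hf If ff.
pose G := gradient_mx v f.
pose C := pinvmx G; have GC : G *m C = 1%:M by apply: mulmxVp.
have [A Afree AC] : exists2 A : 'M[k]_(n.+1, N.+1), row_free A & A *m C = 0.
  have rk : \rank (kermx C) = n.+1.
    rewrite mxrank_ker (_ : \rank C = r); first by rewrite /r subSn ?leq_subr // subKn.
    apply/eqP; rewrite eqn_leq rank_leq_col /=.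
    by rewrite -[X in (X <= _)%N](mxrank1 k) -GC mxrankM_maxr.
  have [A Afree AC] := row_free_sub_rank rk; exists A => //.
  by apply/sub_kermxP.
pose c := pinvmx A; have Ac : A *m c = 1%:M by apply: mulmxVp.
pose J : 'M[{mpoly k[N.+1]}]_(r, N.+1) := \matrix_(i, j) (f i)^`M(j).
pose M := J *m toS C; pose Delta := \det M.
pose W : 'M[{mpoly k[N.+1]}]_(N.+1, n.+1) := Delta *: toS c - toS C *m (\adj M *m (J *m toS c)).
pose D i := vfield (fun j => Delta * W j i).
pose x j : {mpoly k[N.+1]} := \sum_l A j l *: 'X_l.
have evJ w : ev w J = gradient_mx w f.
  by apply/matrixP => i j; rewrite !mxE.
have evM w : ev w M = gradient_mx w f *m C by rewrite map_mxM evJ ev_const.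
have JW : J *m W = 0.
  rewrite mulmxBr -scalemxAr !mulmxA mul_mx_adj mul_scalar_mx.
  by rewrite -scalemxAl subrr.
have homM i j : M i j \is (e.-1).-homog.
  rewrite mxE; apply: rpred_sum => l _; rewrite !mxE mulrC mul_mpolyC.
  by apply/dhomogZ/homog_deriv.
have homD : Delta \is (r * e.-1).-homog by apply: homog_det.
have homW j i : W j i \is (r * e.-1).-homog.
  rewrite mxE; apply: rpredD.
    by rewrite mxE mulrC !mxE mul_mpolyC dhomogZ.
  rewrite mxE rpredN mxE; apply: rpred_sum => l _; rewrite !mxE mul_mpolyC.
  apply: dhomogZ; apply: rpred_sum => l' _.
  have -> : (r * e.-1 = r.-1 * e.-1 + e.-1)%N.
    by rewrite -{1}(prednK (leq_ltn_trans (leq0n _) (ltn_ord l))) mulSn addnC.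
  apply: homogM.
    rewrite mxE /cofactor -signr_odd.
    have hdet : \det (row' l' (col' l M)) \is (r.-1 * e.-1).-homog.
      by apply: homog_det => a b; rewrite 2!mxE; apply: homM.
    by case: odd; rewrite ?mulN1r ?mul1r ?rpredN.
  rewrite mxE; apply: rpred_sum => b _; rewrite !mxE mulrC mul_mpolyC.
  by apply/dhomogZ/homog_deriv.
exists D, x, (Delta ^+ 2); split.
- by move=> i; exists (fun j => Delta * W j i).
- move=> i e' p hp; exists (e'.-1 + (r * e.-1 + r * e.-1))%N.
  by apply: vfield_homog => // j; apply: homogM.
- move=> i e' p hp Ip w Xw; rewrite /D.
  have evW : forall j, (Delta * W j i).@[w 0] = (Delta.@[w 0] *: col i (ev w W)) j 0.
    by move=> j; rewrite mevalM !mxE.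
  rewrite (vfield_eval p evW) -scalemxAr mxE.
  have [->|nz] := eqVneq Delta.@[w 0] 0; first by rewrite mul0r.
  have nzM : \det (gradient_mx w f *m C) != 0.
    by rewrite -evM det_map_mx.
  have rk : \rank (gradient_mx w f) = r.
    apply/eqP; rewrite eqn_leq rank_leq_row /=.
    have := mxrankM_maxl (gradient_mx w f) C; rewrite mxrank_unit //.
    by rewrite unitmxE unitfE.
  have sub : (gradient w p <= gradient_mx w f)%MS.
    apply/negPn/negP => nsub.
    have : (gradient_mx w f < col_mx (gradient_mx w f) (gradient w p))%MS.
      by rewrite /ltmx -!addsmxE addsmxSl addsmx_sub submx_refl.
    move/rank_ltmx; rewrite rk ltnNge.
    have -> : col_mx (gradient_mx w f) (gradient w p) =
        gradient_mx w (fun i => match split i with inl j => f j | inr _ => p end).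
      apply/row_matrixP => a; rewrite rowK; case: (split_ordP a) => b -> .
        by rewrite rowKu rowK.
      by rewrite rowKd ord1 row_id.
    rewrite (gradient_rank_le X_smooth) // => a; case: split => b.
      by split; [exists e | apply: If].
    by split=> //; exists e'.
  have /submxP[y ->] := sub.
  rewrite -mulmxA -evJ colE [ev w J *m (_ *m _)]mulmxA -map_mxM JW map_mx0 mul0mx mulmx0.
  by rewrite mxE mulr0.
- by move=> j; apply: rpred_sum => l _; apply/dhomogZ/homog_var.
split=> [i j|].
  rewrite /D vfield_linear.
  have : (toS A *m W) j i = Delta *+ (i == j).
    rewrite mulmxBr -scalemxAr !mulmxA -!map_mxM AC Ac map_mx0 !mul0mx subr0 map_mx1.
    by rewrite !mxE mulr_natr eq_sym.
  rewrite mxE expr2 -mulrnAr => <-; rewrite mulr_sumr; apply: eq_bigr => l _.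
  by rewrite !mxE mul_mpolyC scalerAr.
rewrite rmorphXn expf_neq0 //= -[Delta.@[_]]det_map_mx evM -/G GC det1.
exact: oner_neq0.
Qed.

End TangentialFrame.

(** * The prime ideal of a smooth germ *)

Section GermIdeal.
Variables (k : numFieldType) (N n : nat) (v : 'rV[k]_N).
Variables (D : 'I_n -> {mpoly k[N]} -> {mpoly k[N]}).

(** Iterated derivatives are taken in the order of [s], each field in turn: this
    avoids commuting vector fields, and makes primality an iteration of
    [dcore_prime]. *)
Definition germ_along (s : seq 'I_n) : {mpoly k[N]} -> Prop :=
  foldr (fun i P => dcore (D i) P) (fun p => p.@[v 0] = 0) s.

Definition germ_ideal := germ_along (enum 'I_n).

Lemma germ_along_point s p : germ_along s p -> p.@[v 0] = 0.
Proof. by elim: s p => //= i s IHs p /dcore_sub; apply: IHs. Qed.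

Lemma point_prime : is_prime (fun p : {mpoly k[N]} => p.@[v 0] = 0).
Proof.
split; first split.
- exact: meval0.
- by move=> p q; rewrite mevalD => -> ->; rewrite addr0.
- by move=> p q; rewrite mevalM => ->; rewrite mulr0.
- by rewrite meval1; apply/eqP/oner_neq0.
by move=> p q; rewrite mevalM => /eqP; rewrite mulf_eq0 => /orP[] /eqP; [left|right].
Qed.

Hypothesis D_vfield : forall i, exists a, D i = vfield a.

Let DD i p q : D i (p + q) = D i p + D i q.
Proof. by have [a ->] := D_vfield i; apply: vfieldD. Qed.
Let DM i p q : D i (p * q) = D i p * q + p * D i q.
Proof. by have [a ->] := D_vfield i; apply: vfieldM. Qed.
Let DC i c : D i c%:MP = 0.
Proof. by have [a ->] := D_vfield i; apply: vfieldC. Qed.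

Lemma dcore_vfield_prime i P : is_prime P -> is_prime (dcore (D i) P).
Proof.
move=> pP; have [iP _ _] := pP.
exact: (dcore_prime (DD i) (DM i) (mpoly_ideal_mulrn iP) pP).
Qed.

Lemma germ_along_prime s : is_prime (germ_along s).
Proof. by elim: s => [|i s IHs]; [apply: point_prime | apply: dcore_vfield_prime]. Qed.

Hypothesis D_homog : forall i e p, p \is e.-homog -> exists e', D i p \is e'.-homog.

Lemma iter_homog i r e p : p \is e.-homog -> exists e', iter r (D i) p \is e'.-homog.
Proof.
by move=> hp; elim: r => [|r [e' /(D_homog i)]]; [exists e | rewrite iterS].
Qed.

Lemma germ_contains (J : {mpoly k[N]} -> Prop) :
    (forall i e p, p \is e.-homog -> J p -> J (D i p)) ->
    (forall e p, p \is e.-homog -> J p -> p.@[v 0] = 0) ->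
  form_sub J germ_ideal.
Proof.
move=> JD Jv; rewrite /germ_ideal; elim: (enum _) => [|i s IHs] e p hp Jp /=; first exact: Jv hp Jp.
move=> r; have [e1 hr1] := iter_homog i r hp; apply: IHs hr1 _.
elim: r => // r IHr; have [e' hr] := iter_homog i r hp.
by rewrite iterS; apply: JD hr IHr.
Qed.

Variables (x : 'I_n -> {mpoly k[N]}) (Delta : {mpoly k[N]}).
Hypotheses (D_x : forall i j, D i (x j) = Delta *+ (i == j)) (Delta_v : Delta.@[v 0] != 0).

Lemma vfield_subst i p : D i (p \@ x) = Delta * (p^`M(i) \@ x).
Proof.
rewrite (mmap_chain_rule x (DD i) (DM i) (DC i)) (bigD1 i) //= D_x eqxx mulrC.
rewrite big1 ?addr0 // => j ne_ji.
by rewrite D_x eq_sym (negPf ne_ji) mulr0.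
Qed.

(** On polynomials in [x] the field [D i] is [Delta] times the partial derivative,
    and [Delta] is not in the prime ideal: partial derivatives in [x] may thus be
    taken without leaving the ideal. *)
Lemma germ_along_mderiv s p (m : 'X_{1..n}) :
    (forall i, m i != 0%N -> i \in s) -> germ_along s (p \@ x) ->
  (p^`M[m] \@ x).@[v 0] = 0.
Proof.
elim: s p m => [|i s IHs] p m sm gp.
  have -> : m = 0%MM by apply/mnmP => i; rewrite mnm0E; apply/eqP/negPn/negP => /sm.
  by rewrite mderivm0m; apply: gp.
pose m' := [multinom (if j == i then 0%N else m j) | j < n].
have -> : m = (U_(i) *+ m i + m')%MM.
  apply/mnmP => j; rewrite mnmDE mulmnE mnm1E mnmE [i == j]eq_sym.
  by case: eqP => [->|_]; rewrite ?mul1n ?addn0 ?mul0n.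
rewrite mderivmDm; apply: IHs => [j|].
  by rewrite mnmE; case: ifPn => [_ /negP[]|ne_ji /sm] //; rewrite inE (negPf ne_ji).
apply: (@dcore_sub _ (D i)); elim: (m i) => [|e IHe]; first by rewrite mulm0n mderivm0m.
rewrite mderivnS; apply: (@prime_cancel _ _ Delta _ (germ_along_prime (i :: s))).
  by move/germ_along_point/eqP; apply/negP.
by rewrite -vfield_subst; apply: dcore_stable IHe.
Qed.

Lemma germ_alg_indep : alg_indep germ_ideal x.
Proof.
move=> s p _ gp; apply: (@mpoly_taylor0 _ _ _ (fun i => (x i).@[v 0])) => m.
by rewrite -subst_eval; apply: germ_along_mderiv gp => i _; rewrite mem_enum.
Qed.

End GermIdeal.

(** * Irreducibility *)

(** A prime of maximal dimension above [I] whose zero locus passes through [v]. *)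
Definition component_at (k : fieldType) N n (I : {mpoly k[N]} -> Prop) (v : 'rV[k]_N)
    (P : {mpoly k[N]} -> Prop) (x : 'I_n -> {mpoly k[N]}) :=
  [/\ is_prime P, form_sub I P, forall e p, p \is e.-homog -> P p -> p.@[v 0] = 0,
      forall i, x i \is 1.-homog & alg_indep P x].

Section Components.
Variables (k : numFieldType) (N n d : nat) (X : 'rV[k]_N.+1 -> Prop).
Notation I := (vanishing X).
Hypothesis X_nz : forall v, X v -> v != 0.
Hypothesis X_smooth : smooth_pure_dim X n.
Hypothesis I_deg : hilbert_degree I n d.

(** All such primes [J] have the same forms as the germ ideal [P] at [v].  Indeed
    [J] is stable under the tangential fields, as [dcore (D i) J] is again a prime
    above [I]; since its forms vanish at [v], they belong to [P], and equality
    follows by maximality of the dimension. *)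
Lemma unique_component v : X v ->
  exists P x, @component_at k N.+1 n.+1 I v P x /\
    forall J y, @component_at k N.+1 n.+1 I v J y -> form_sub J P /\ form_sub P J.
Proof.
move=> Xv; have [D [x [Delta [Dvf Dh DI hx [Dx nzD]]]]] := exists_tangential_frame X_nz X_smooth Xv.
pose P := germ_ideal v D.
have pP : is_prime P by apply: germ_along_prime.
have iP : is_ideal P by case: pP.
have indP : alg_indep P x by apply: germ_alg_indep Dx nzD.
have Iv e p : p \is e.-homog -> I p -> p.@[v 0] = 0 by move=> _; apply.
exists P, x; split.
  split=> //; first by apply: germ_contains => //.
  by move=> e p _; apply: germ_along_point.
move=> J y [pJ IJ Jv hy indJ]; have iJ : is_ideal J by case: pJ.
have JP : form_sub J P.
  apply: germ_contains => // i e p hp Jp.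
  have pJ' : is_prime (dcore (D i) J) by apply: dcore_vfield_prime.
  suff JJ' : form_sub J (dcore (D i) J) by have := JJ' e p hp Jp 1%N.
  apply: (prime_maximal_dim I_deg pJ' iJ _ _ hy indJ) => [e1 q hq Iq r|e1 q _ /dcore_sub//].
  have [e2 h2] := iter_homog Dh i r hq; apply: IJ h2 _.
  elim: r {e2} => // r IHr; have [e2 h2] := iter_homog Dh i r hq.
  by rewrite iterS; apply: DI h2 IHr.
by split=> //; apply: (prime_maximal_dim I_deg pJ iP IJ JP hx indP).
Qed.

(** A product [u i] of forms of all the other primes, nonzero at [w i], is killed
    by all primes but [P i]; so the [u i] generate a direct sum of modules over
    polynomial rings in [n.+1] variables. *)
Lemma components_le_degree K (w : 'I_K -> 'rV[k]_N.+1) P x :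
    (forall i, X (w i)) -> (forall i, @component_at k N.+1 n.+1 I (w i) (P i) (x i)) ->
    (forall i j, i != j -> exists2 a, (exists e, a \is e.-homog) & P j a /\ a.@[w i 0] != 0) ->
  (K <= d)%N.
Proof.
move=> Xw comp sep.
have /choice[a ha] : forall ij : 'I_K * 'I_K, exists a, ij.1 != ij.2 ->
    (exists e, a \is e.-homog) /\ P ij.2 a /\ a.@[w ij.1 0] != 0.
  move=> [i j] /=; have [->|ne] := eqVneq i j; first by exists 0.
  by have [a ha Pa] := sep i j ne; exists a.
have /choice[e he] : forall ij : 'I_K * 'I_K, exists e, ij.1 != ij.2 -> a ij \is e.-homog.
  move=> ij; have [e|ne] := eqVneq ij.1 ij.2; first by exists 0%N.
  by have [[e he] _] := ha ij ne; exists e.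
have /choice[l hl] : forall i, exists l, w i 0 l != 0.
  by move=> i; apply/rV0Pn/X_nz.
pose f i := (\sum_(j | i != j) e (i, j))%N.
pose E := \max_i f i.
pose u i : {mpoly k[N.+1]} := 'X_(l i) ^+ (E - f i) * \prod_(j | i != j) a (i, j).
have hu i : u i \is E.-homog.
  rewrite -(@subnK (f i) E); last exact: leq_bigmax.
  apply: homogM; last by apply: homog_prod => j; apply: he (i, j).
  by have := homogXn (E - f i) (homog_var k (l i)); rewrite mul1n.
have uw i : (u i).@[w i 0] != 0.
  rewrite mevalM mulf_neq0 //; first by rewrite rmorphXn /= mevalXU expf_neq0.
  rewrite rmorph_prod; apply/prodf_neq0 => j ne.
  by have [_ [_]] := ha (i, j) ne.
have uP i j : i != j -> P j (u i).
  move=> ne; have [[iP _ _] _ _ _ _] := comp j; have [_ _ PM] := iP; apply: PM.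
  by apply: (ideal_prod (j := j)) => //; have [_ []] := ha (i, j) ne.
apply: (free_family_le_degree I_deg hu (x := x)).
  by move=> i j; have [_ _ _ + _] := comp i; apply.
move=> s p hp Isum i; have [pP IP Pv hx indP] := comp i; have [iP _ _] := pP.
apply: indP (hp i) _.
have hpx j : p j \@ x j \is s.-homog.
  by have [_ _ _ hxj _] := comp j; have := subst_homog hxj (hp j); rewrite mul1n.
apply: (@prime_cancel _ _ (u i) _ pP) => [/(Pv _ _ (hu i))/eqP|].
  by apply/negP; apply: uw.
have Psum : P i (\sum_i u i * (p i \@ x i)).
  apply: (IP (E + s)%N) => //; apply: rpred_sum => j _; exact: homogM.
have Prest : P i (\sum_(j | j != i) u j * (p j \@ x j)).
  by apply: ideal_sum => // j ne; apply: idealMr => //; apply: uP.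
by have := idealB iP Psum Prest; rewrite (bigD1 i) //= addrK.
Qed.

End Components.

Section Irreducibility.
Variables (R : realType) (N n d : nat) (X : set 'rV[R[i]]_N.+1).
Hypotheses (X_closed : proj_closed X) (X_connected : zariski_connected X).
Hypotheses (X_smooth : smooth_of_dim X n) (X_degree : has_degree X n d).
Notation I := (vanishing X).

Lemma closed_neq0 v : X v -> v != 0.
Proof. by have [F _ ->] := X_closed; case. Qed.

Lemma degree_of_ideal : hilbert_degree I n d.
Proof. exact: X_degree. Qed.

Let comp_exists v : X v ->
  exists P x, @component_at _ N.+1 n.+1 I v P x /\
    forall J y, @component_at _ N.+1 n.+1 I v J y -> form_sub J P /\ form_sub P J.
Proof. exact: (unique_component closed_neq0 X_smooth degree_of_ideal). Qed.

(** The zero loci of the primes at a maximal list of separated points cover [X].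
    One of them, [V (w ord0)], is disjoint from the zero locus [B] of the forms that
    belong to all the other primes, because there are finitely many of these. *)
Lemma ideal_prime : exists P x, [/\ is_prime P, form_sub I P, form_sub P I,
  forall i : 'I_n.+1, x i \is 1.-homog & alg_indep P x].
Proof.
have [v0 Xv0] := X_connected.1.
have /choice[C hC] : forall v, exists C : ({mpoly R[i][N.+1]} -> Prop) * ('I_n.+1 -> {mpoly R[i][N.+1]}),
    X v -> component_at I v C.1 C.2 /\
    forall J (y : 'I_n.+1 -> _), component_at I v J y -> form_sub J C.1 /\ form_sub C.1 J.
  move=> v; have [Xv|nXv] := pselect (X v); last by exists (fun=> True, fun=> 0).
  by have [P [x hP]] := comp_exists Xv; exists (P, x).
pose P v := (C v).1; pose x v := (C v).2.
have cP v : X v -> component_at I v (P v) (x v) by move=> /hC[].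
pose V v := [set u : 'rV[R[i]]_N.+1 | u != 0 /\
  forall p, ((exists e, p \is e.-homog) /\ P v p) -> p.@[u 0] = 0]%classic.
have VX v : X v -> (V v `<=` X)%classic.
  move=> Xv u [nzu Vu]; have [F hF XE] := X_closed; rewrite XE; split=> // p Fp.
  have [e he] := hF p Fp; apply: Vu; split; first by exists e.
  have [_ IP _ _ _] := cP v Xv; apply: IP he _ => w; rewrite {1}XE => -[_]; apply.
  exact: Fp.
have VP v w : X v -> V v w -> form_sub (P v) (P w) /\ form_sub (P w) (P v).
  move=> Xv Vw; have Xw := VX v Xv w Vw; have [_ hw] := hC w Xw.
  have [pP IP _ hx indx] := cP v Xv; apply: (hw _ (x v)); split=> //.
  by move=> e p he Pp; apply: Vw.2; split=> //; exists e.
have Vv v : X v -> V v v.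
  move=> Xv; split; first exact: closed_neq0.
  by move=> p [[e he] Pp]; have [_ _ Pv _ _] := cP v Xv; apply: Pv he Pp.
have VVsym v w : X v -> X w -> V v w -> V w v.
  move=> Xv Xw Vw; split; first exact: closed_neq0.
  move=> p [[e he] Pp]; have [_ sub] := VP v w Xv Vw.
  by apply: (Vv v Xv).2; split; [exists e | apply: sub he Pp].
have sepV v w : X w -> ~ V v w -> exists2 a, (exists e, a \is e.-homog) & P v a /\ a.@[w 0] != 0.
  move=> Xw nV; apply: contrapT => nex; apply: nV; split; first exact: closed_neq0.
  move=> p [hp Pp]; apply/eqP/negPn/negP => nz; apply: nex; exists p => //.
pose sep K := exists w : 'I_K.+1 -> 'rV[R[i]]_N.+1,
  [/\ w ord0 = v0, forall i, X (w i) & forall i j, i != j -> ~ V (w j) (w i)].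
have sepd K : `[< sep K >] -> (K <= d)%N.
  move=> /asboolP[w [_ Xw sepw]]; apply: ltnW.
  apply: (components_le_degree closed_neq0 degree_of_ideal (w := w) (P := P \o w) (x := x \o w)) => //.
    by move=> i; apply: cP.
  by move=> i j ne; apply: sepV => //; apply: sepw.
have ex_sep : exists K, `[< sep K >].
  by exists 0%N; apply/asboolP; exists (fun=> v0); split=> // i j; rewrite !ord1.
case: (ex_maxnP ex_sep sepd) => K /asboolP[w [w0 Xw sepw]] maxK {sepd ex_sep}.
have cover u : X u -> exists i, V (w i) u.
  move=> Xu; apply: contrapT => /forallNP nV.
  suff /asboolP/maxK : sep K.+1 by rewrite ltnn.
  exists (fun i => oapp w u (unlift ord_max i)); split.
  - have -> : ord0 = lift ord_max (ord0 : 'I_K.+1) by apply: val_inj.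
    by rewrite liftK.
  - by move=> i; case: unliftP => [j|] _ /=; [apply: Xw | apply: Xu].
  move=> i j; case: (unliftP ord_max i) => [i'|] ->; case: (unliftP ord_max j) => [j'|] -> /=.
  - by rewrite (inj_eq lift_inj); apply: sepw.
  - by move=> _ /(VVsym _ _ Xu (Xw _)); apply: nV.
  - by move=> _; apply: nV.
  by rewrite eqxx.
pose B := [set u : 'rV[R[i]]_N.+1 | u != 0 /\
  forall p, ((exists e, p \is e.-homog) /\ forall i, i != ord0 -> P (w i) p) -> p.@[u 0] = 0]%classic.
have closedA : proj_closed (V (w ord0)).
  by exists (fun p => (exists e, p \is e.-homog) /\ P (w ord0) p) => [p []|].
have closedB : proj_closed B.
  by exists (fun p => (exists e, p \is e.-homog) /\ forall i, i != ord0 -> P (w i) p) => [p []|].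
have XAB : X = (V (w ord0) `|` B)%classic.
  apply/seteqP; split=> [u Xu|u [/(VX _ (Xw _))//|[nzu Bu]]].
    have [i Vi] := cover u Xu; have [<-|ne] := eqVneq i ord0; first by left.
    right; split; first exact: closed_neq0.
    by move=> p [hp Pp]; apply: Vi.2; split=> //; apply: Pp.
  have [F hF XE] := X_closed; rewrite XE; split=> // p Fp.
  have [e he] := hF p Fp; apply: Bu; split; first by exists e.
  move=> i _; have [_ IP _ _ _] := cP _ (Xw i); apply: IP he _ => u'; rewrite {1}XE => -[_]; apply.
  exact: Fp.
have AB0 : (V (w ord0) `&` B)%classic = set0.
  apply/seteqP; split=> // u [Vu [nzu Bu]].
  have Xu := VX _ (Xw _) u Vu.
  have nVi i : i != ord0 -> ~ V (w i) u.
    move=> ne Vi; apply: (sepw _ _ ne); have [s1 s2] := VP _ _ (Xw _) Vu.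
    have [s3 s4] := VP _ _ (Xw _) Vi; split; first exact: closed_neq0.
    move=> p [[e he] Pp]; apply: (Vv _ (Xw i)).2; split; first by exists e.
    by apply: (s4 e p he); apply: (s1 e p he).
  have /choice[g hg] : forall i, exists g, i != ord0 ->
      (exists e, g \is e.-homog) /\ P (w i) g /\ g.@[u 0] != 0.
    move=> i; have [->|ne] := eqVneq i ord0; first by exists 0.
    by have [a ha Pa] := sepV _ _ Xu (nVi i ne); exists a.
  have /choice[e he] : forall i, exists e, i != ord0 -> g i \is e.-homog.
    move=> i; have [->|ne] := eqVneq i ord0; first by exists 0%N.
    by have [[e he] _] := hg i ne; exists e.
  suff /eqP : (\prod_(i | i != ord0) g i).@[u 0] = 0.
    rewrite rmorph_prod; apply/negP; apply/prodf_neq0 => i ne.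
    by have [_ []] := hg i ne.
  apply: Bu; split; first by exists (\sum_(i | i != ord0) e i)%N; apply: homog_prod.
  move=> i ne; have [[iP _ _] _ _ _ _] := cP _ (Xw i).
  by apply: (ideal_prod (j := i)) => //; have [_ []] := hg i ne.
have [_ conn] := X_connected.
have [A0|B0] := conn _ _ closedA closedB XAB AB0.
  by have : (@set0 'rV[R[i]]_N.+1) (w ord0) by rewrite -A0; apply: Vv.
have [pP IP _ hx indx] := cP _ (Xw ord0).
exists (P (w ord0)), (x (w ord0)); split=> // e p he Pp u.
by rewrite XAB B0 setU0 => -[_]; apply; split=> //; exists e.
Qed.

End Irreducibility.

(** * Finiteness over linear forms *)

Section MoreSubstitution.
Variables (k : fieldType).

Lemma subst_ext q n (p : {mpoly k[q]}) (y z : 'I_q -> {mpoly k[n]}) :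
  y =1 z -> p \@ y = p \@ z.
Proof. by move=> e; apply: eq_bigr => m _; congr (_ * _); apply: mmap1_eq. Qed.

Lemma subst_subst q r n (p : {mpoly k[q]}) (y : 'I_q -> {mpoly k[r]}) (z : 'I_r -> {mpoly k[n]}) :
  (p \@ y) \@ z = p \@ (fun i => y i \@ z).
Proof.
elim/mpoly_ring_ind: p => [c|j|p p' IHp IHp'|p p' IHp IHp'].
- by rewrite !mmapC.
- by rewrite !mmapX !mmap1U.
- by rewrite !mmapD IHp IHp'.
- by rewrite !rmorphM /= IHp IHp'.
Qed.

Lemma subst_scaled_form q n e (p : {mpoly k[q]}) (r : 'I_q -> k) (w : {mpoly k[n]}) :
  p \is e.-homog -> p \@ (fun i => r i *: w) = p.@[r] *: w ^+ e.
Proof.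
move=> hp; rewrite mevalE scaler_suml /mmap big_seq [RHS]big_seq.
apply: eq_bigr => m /(dhomog_mf hp) /= <-; rewrite mul_mpolyC -scalerA; congr (_ *: _).
have -> : mmap1 (fun i => r i *: w) m = \prod_i (r i ^+ m i *: w ^+ m i).
  by apply: eq_bigr => i _; rewrite exprZn.
rewrite mdegE -prodrXr; elim/big_rec3: _ => [|i a b c _ ->]; first by rewrite scale1r.
by rewrite -scalerAl -scalerAr scalerA.
Qed.

Variables (n : nat).

Definition gen_ideal q (y : 'I_q -> {mpoly k[n]}) f := exists g, f = \sum_i y i * g i.

Lemma gen_ideal_ideal q (y : 'I_q -> {mpoly k[n]}) : is_ideal (gen_ideal y).
Proof.
split=> [|f g [a ->] [b ->]|f g [b ->]].
- by exists (fun=> 0); rewrite big1 // => i _; rewrite mulr0.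
- exists (fun i => a i + b i); rewrite -big_split /=.
  by apply: eq_bigr => i _; rewrite mulrDr.
exists (fun i => f * b i); rewrite mulr_sumr.
by apply: eq_bigr => i _; rewrite mulrCA.
Qed.

Lemma gen_ideal_gen q (y : 'I_q -> {mpoly k[n]}) i : gen_ideal y (y i).
Proof.
exists (fun j => (j == i)%:R); rewrite (bigD1 i) //= eqxx mulr1 big1 ?addr0 //.
by move=> j /negPf ->; rewrite mulr0.
Qed.

Lemma gen_ideal_form q (y : 'I_q -> {mpoly k[n]}) t f :
    (forall i, y i \is 1.-homog) -> f \is t.+1.-homog -> gen_ideal y f ->
  exists2 g, (forall i, g i \is t.-homog) & f = \sum_i y i * g i.
Proof.
move=> hy hf [g fg]; exists (fun i => pihomog mdeg t (g i)) => [i|].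
  exact: pihomogP.
rewrite -[LHS](pihomog_dE hf) fg raddf_sum /=; apply: eq_bigr => i _.
by rewrite mulrC -addn1 pihomogM // mulrC.
Qed.

End MoreSubstitution.

Section Noether.
Variables (k : numFieldType) (N n d : nat) (I : {mpoly k[N.+1]} -> Prop).
Hypothesis I_ideal : is_ideal I.
Hypothesis I_proper : ~ I 1.
Hypothesis I_deg : hilbert_degree I n d.

(** In degrees above [m0] the ring modulo [I] is generated by [y] over lower degrees:
    the graded form of finiteness over the polynomial ring [k[y]]. *)
Definition finite_over q (y : 'I_q -> {mpoly k[N.+1]}) m0 :=
  forall t f, (m0 <= t)%N -> f \is t.+1.-homog ->
    exists2 g, (forall i, g i \is t.-homog) & I (f - \sum_i y i * g i).

Let I0 : I 0. Proof. by case: I_ideal. Qed.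
Let ID f g : I f -> I g -> I (f + g). Proof. by case: I_ideal => _ + _; apply. Qed.
Let IM f g : I g -> I (f * g). Proof. by case: I_ideal => _ _; apply. Qed.

Lemma finite_over_variables : finite_over (fun i => 'X_i) 0.
Proof.
move=> t f _ hf; have [|g hg ->] := gen_ideal_form (homog_var k (n := N.+1)) hf; last first.
  by exists g => //; rewrite subrr.
have iX := gen_ideal_ideal (fun i : 'I_N.+1 => 'X_i : {mpoly k[N.+1]}).
rewrite [f]mpolyE big_seq; apply: ideal_sum => // m mf.
rewrite -mul_mpolyC; have [_ _ PM] := iX; apply: (PM).
have [i nzm] : exists i, m i != 0%N.
  apply: contrapT => /forallNP m0; have := dhomog_mf hf mf; rewrite /= mdegE big1 // => i _.
  by apply/eqP/negPn/negP/m0.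
have -> : m = (m - U_(i) + U_(i))%MM by rewrite submK // lep1mP.
by rewrite mpolyXD; apply: (PM); apply: gen_ideal_gen.
Qed.

(** Choose [i0] and linear forms [y' j] that differ from the other [y i] by
    multiples of [w = y i0], in such a way that [F] becomes, modulo [y'], a nonzero
    multiple of [w^e]: then [w] is integral over the ring generated by [y']. *)
Lemma finite_over_reduce q (y : 'I_q.+1 -> {mpoly k[N.+1]}) m0 e (F : {mpoly k[q.+1]}) :
    (forall i, y i \is 1.-homog) -> finite_over y m0 ->
    F \is e.-homog -> (0 < e)%N -> F != 0 -> I (F \@ y) ->
  exists y' : 'I_q -> {mpoly k[N.+1]}, exists m1,
    (forall i, y' i \is 1.-homog) /\ finite_over y' m1.
Proof.
move=> hy finy hF e_gt0 nzF IF.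
have [c nzFc] := mpoly_neq0_point nzF.
have [i0 nzc] : exists i0, c i0 != 0.
  apply: contrapT => /forallNP c0; case/eqP: nzFc.
  have := homog_eval_scale 0 c hF; rewrite expr0n gtn_eqF // mul0r => <-.
  by apply: meval_eq => i; rewrite mul0r; apply/eqP/negPn/negP/c0.
pose r i := (c i0)^-1 * c i.
have nzFr : F.@[r] != 0 by rewrite (homog_eval_scale _ _ hF) mulf_neq0 // expf_neq0 // invr_eq0.
pose w := y i0.
pose y' j := y (lift i0 j) - r (lift i0 j) *: w.
have hw : w \is 1.-homog by apply: hy.
have hy' j : y' j \is 1.-homog by apply: homogB => //; apply: homogZ.
have iG := gen_ideal_ideal y'; have [_ GD GM] := iG.
have yz i : gen_ideal y' (y i - r i *: w).
  case: (unliftP i0 i) => [j|] -> ; first exact: (gen_ideal_gen y' j).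
  by rewrite /r mulVf // scale1r subrr; case: iG.
have Gdiff := subst_congr F iG yz; rewrite (subst_scaled_form r w hF) in Gdiff.
have step e' t f : (m0 + e' <= t)%N -> f \is t.-homog ->
    exists g h, [/\ g \is (t - e').-homog, h \is t.-homog, gen_ideal y' h &
                   I (f - w ^+ e' * g - h)].
  elim: e' => [|e' IHe] in t f *; rewrite ?addnS => le_t hf.
    exists f, 0; split; rewrite ?subn0 ?rpred0 //; first by case: iG.
    by rewrite expr0 mul1r subrr subr0.
  have [g [h [hg hh Gh If]]] := IHe t f (ltnW le_t) hf.
  have te : (t - e' = (t - e'.+1).+1)%N by lia.
  rewrite te in hg; have [|a ha Ig] := finy (t - e'.+1)%N g _ hg; first by lia.
  exists (\sum_i r i *: a i), (h + w ^+ e' * \sum_i (y i - r i *: w) * a i); split.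
  - by apply: homog_sum => i _; apply: homogZ.
  - apply: homogD => //; have -> : t = (1 * e' + (t - e'.+1).+1)%N by lia.
    apply: homogM; first exact: homogXn.
    apply: homog_sum => i _; apply: (@homogM _ _ 1%N (t - e'.+1)) => //.
    by apply: homogB => //; apply: homogZ.
  - apply: GD => //; apply: GM; apply: ideal_sum => // i _.
    by apply: idealMr.
  have -> : f - w ^+ e'.+1 * (\sum_i r i *: a i) -
      (h + w ^+ e' * (\sum_i (y i - r i *: w) * a i)) =
      (f - w ^+ e' * g - h) + w ^+ e' * (g - \sum_i y i * a i).
    have -> : \sum_i (y i - r i *: w) * a i = \sum_i y i * a i - w * \sum_i r i *: a i.
      rewrite mulr_sumr -sumrB; apply: eq_bigr => i _.
      by rewrite mulrBl -scalerAl -scalerAr.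
    by rewrite exprS; ring.
  by apply: ID => //; apply: IM.
exists y', (m0 + e)%N; split=> // t f le_t hf.
have [g [h [hg hh Gh If]]] := step e t.+1 f (leq_trans le_t (leqnSn _)) hf.
pose b := (F.@[r])^-1.
pose h' := h - b *: (F \@ y - F.@[r] *: w ^+ e) * g.
have hh' : h' \is t.+1.-homog.
  apply: homogB => //; rewrite -(subnKC (_ : e <= t.+1)%N); last by lia.
  apply: homogM => //; apply: homogZ; apply: homogB.
    by have := subst_homog hy hF; rewrite mul1n.
  by apply: homogZ; have := homogXn e hw; rewrite mul1n.
have Gh' : gen_ideal y' h'.
  apply: idealB => //; apply: idealMr => //.
  by have := GM b%:MP _ Gdiff; rewrite mul_mpolyC.
have [a ha h'E] := gen_ideal_form hy' hh' Gh'.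
exists a => //; rewrite -h'E.
have -> : f - h' = (f - w ^+ e * g - h) + (b *: g) * (F \@ y).
  rewrite /h' -!mul_mpolyC; have : b%:MP * (F.@[r])%:MP = 1 :> {mpoly k[N.+1]}.
    by rewrite -mpolyCM mulVf.
  move: (b%:MP_[N.+1]) ((F.@[r])%:MP_[N.+1]) (F \@ y) (w ^+ e) => b1 c1 Y z bc.
  have -> : f - (h - b1 * (Y - c1 * z) * g) = f - h + b1 * Y * g - (b1 * c1) * z * g by ring.
  by rewrite bc; ring.
by apply: ID => //; apply: IM.
Qed.

Lemma relation_pos_degree q (y : 'I_q -> {mpoly k[N.+1]}) e (F : {mpoly k[q]}) :
  F \is e.-homog -> F != 0 -> I (F \@ y) -> (0 < e)%N.
Proof.
case: e => // /homog0_const -> ; rewrite mmapC mpolyC_eq0 => nz IF; case: I_proper.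
by have := IM (F@_0%MM)^-1%:MP IF; rewrite -mpolyCM mulVf.
Qed.

Let isolate_last q (i : 'I_q.+1) : {poly {mpoly k[n.+1]}} :=
  if i == ord_max then 'X else (\sum_(j : 'I_n.+1 | (j == i :> nat)) 'X_j)%:P.

(** A transcendental over [n.+1] algebraically independent forms would have
    [d.+1] independent powers. *)
Lemma forms_dependent q (y : 'I_q.+1 -> {mpoly k[N.+1]}) :
  (n < q)%N -> (forall i, y i \is 1.-homog) ->
  exists e, exists2 F : {mpoly k[q.+1]}, F \is e.-homog & F != 0 /\ I (F \@ y).
Proof.
move=> lt_nq hy; apply: contrapT => nex.
have indy : alg_indep I y.
  move=> s p hp Ip; apply/eqP/negPn/negP => nz; apply: nex.
  by exists s, p.
pose wd (j : 'I_n.+1) : 'I_q.+1 := widen_ord (leqW lt_nq) j.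
pose x j := y (wd j).
pose u (b : 'I_d.+1) := y ord_max ^+ b * x ord0 ^+ (d - b).
have hu b : u b \is d.-homog.
  have := homogM (homogXn b (hy ord_max)) (homogXn (d - b) (hy (wd ord0))).
  by rewrite !mul1n subnKC // -ltnS.
have hx (b : 'I_d.+1) j : x j \is 1.-homog by apply: hy.
suff /(free_family_le_degree I_deg hu hx) : free_family I u (fun=> x) by rewrite ltnn.
move=> s p hp Isum.
pose G : {mpoly k[q.+1]} :=
  \sum_(b < d.+1) 'X_ord_max ^+ b * 'X_(wd ord0) ^+ (d - b) * (p b \@ (fun j => 'X_(wd j))).
have hG : G \is (d + s).-homog.
  apply: homog_sum => b _; apply: homogM; last first.
    by have := subst_homog (fun j => homog_var k (wd j)) (hp b); rewrite mul1n.
  have := homogM (homogXn b (homog_var k (@ord_max q))) (homogXn (d - b) (homog_var k (wd ord0))).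
  by rewrite !mul1n subnKC // -ltnS.
have G0 : G = 0.
  apply: (indy _ _ hG); congr (I _): Isum; rewrite rmorph_sum; apply: eq_bigr => b _.
  rewrite !rmorphM !rmorphXn /= !mmapX !mmap1U subst_subst; congr (_ * _).
  by apply: subst_ext => j; rewrite mmapX mmap1U.
pose phi := mmap (polyC \o @mpolyC n.+1 k) (@isolate_last q).
have phiw j : phi 'X_(wd j) = ('X_j)%:P.
  rewrite /phi mmapX mmap1U /isolate_last ifN; last first.
    by rewrite -val_eqE /= ltn_eqF // (leq_trans (ltn_ord j)).
  by rewrite (bigD1 j) //= big1 ?addr0 // => j' /andP[/eqP e /eqP[]]; apply: val_inj.
have phip b : phi (p b \@ (fun j => 'X_(wd j))) = (p b)%:P.
  elim/mpoly_ring_ind: (p b) => [c|j|f g IHf IHg|f g IHf IHg].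
  - by rewrite mmapC /phi mmapC.
  - by rewrite mmapX mmap1U phiw.
  - by rewrite mmapD /phi raddfD /= -/phi IHf IHg polyCD.
  - by rewrite rmorphM /phi rmorphM /= -/phi IHf IHg polyCM.
have /(congr1 (fun f : {poly _} => f)) : phi G = 0 by rewrite G0 /phi raddf0.
have -> : phi G = \poly_(b < d.+1) ('X_ord0 ^+ (d - b) * p (inord b)).
  rewrite poly_def /phi rmorph_sum; apply: eq_bigr => b _.
  rewrite !rmorphM !rmorphXn /= -/phi phip phiw inord_val.
  rewrite /phi mmapX mmap1U /isolate_last eqxx -mul_polyC polyCM rmorphXn /=.
  by rewrite -mulrA mulrC.
move=> G0' b; have := congr1 (fun f : {poly _} => f`_b) G0'.
rewrite coef_poly ltn_ord inord_val coef0 => /eqP.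
rewrite mulf_eq0 expf_eq0.
by rewrite (negPf (var_neq0 _ _)) andbF => /eqP.
Qed.

(** Monomials of degree [m0] generate everything in degrees above [m0]. *)
Lemma finite_over_span q (y : 'I_q -> {mpoly k[N.+1]}) m0 s f :
    (forall i, y i \is 1.-homog) -> finite_over y m0 -> f \is (m0 + s).-homog ->
  exists2 p : 'I_'C(m0 + N, m0) -> {mpoly k[q]}, (forall i, p i \is s.-homog) &
    I (f - \sum_i 'X_[hmon i] * (p i \@ y)).
Proof.
move=> hy finy; elim: s f => [|s IHs] f hf.
  exists (fun i => (f@_(hmon i))%:MP) => [i|]; first exact: homogC.
  rewrite addn0 in hf; rewrite [X in X - _](homog_hmonE hf) -sumrB big1 // => i _.
  by rewrite mmapC mulrC mul_mpolyC subrr.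
rewrite addnS in hf; have [g hg Ifg] := finy _ _ (leq_addr _ _) hf.
have /choice[p hp] : forall j, exists p : 'I_'C(m0 + N, m0) -> {mpoly k[q]},
    (forall i, p i \is s.-homog) /\ I (g j - \sum_i 'X_[hmon i] * (p i \@ y)).
  by move=> j; have [p] := IHs (g j) (hg j); exists p.
exists (fun i => \sum_j 'X_j * p j i) => [i|].
  apply: homog_sum => j _; apply: (@homogM _ _ 1%N s); first exact: homog_var.
  by case: (hp j).
have -> : f - \sum_i 'X_[hmon i] * ((\sum_j 'X_j * p j i) \@ y) =
    (f - \sum_j y j * g j) + \sum_j y j * (g j - \sum_i 'X_[hmon i] * (p j i \@ y)).
  have -> : \sum_i 'X_[hmon i] * ((\sum_j 'X_j * p j i) \@ y) =
      \sum_j y j * \sum_i 'X_[hmon i] * (p j i \@ y).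
    under [RHS]eq_bigr => j _ do rewrite mulr_sumr.
    rewrite exchange_big /=; apply: eq_bigr => i _.
    rewrite rmorph_sum mulr_sumr; apply: eq_bigr => j _.
    by rewrite rmorphM /= mmapX mmap1U mulrCA.
  under [X in _ = _ + X]eq_bigr => j _ do rewrite mulrBr.
  by rewrite sumrB addrA subrK.
by apply: ID => //; apply: ideal_sum => // j _; apply: IM; case: (hp j).
Qed.

End Noether.

(** * Noether normalization *)

Section NoetherNormalization.
Variables (k : numFieldType) (N n d : nat) (I : {mpoly k[N.+1]} -> Prop).
Hypothesis I_ideal : is_ideal I.
Hypothesis I_proper : ~ I 1.
Hypothesis I_deg : hilbert_degree I n d.
Variable x : 'I_n.+1 -> {mpoly k[N.+1]}.
Hypothesis x_homog : forall i, x i \is 1.-homog.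
Hypothesis x_indep : alg_indep I x.

Lemma free_family_one : free_family I (fun _ : 'I_1 => 1) (fun _ : 'I_1 => x).
Proof. by move=> s p hp; rewrite big_ord1 mul1r => Ip i; rewrite ord1; apply: x_indep Ip. Qed.

Lemma binomial_outgrows n' s K : (K * n'.+1 <= s)%N -> (K * 'C(s + n', s) < 'C(s + n'.+1, s))%N.
Proof.
move=> le_Ks; have := mul_bin_left (s + n'.+1) s.
have e : (n'.+1 * 'C(s + n'.+1, s) = (s + n'.+1) * 'C(s + n', s))%N.
  rewrite -(bin_sub (leq_addr n'.+1 s)) -(bin_sub (leq_addr n' s)) !addKn.
  by rewrite -mul_bin_diag addnS.
move=> _; rewrite -(ltn_pmul2l (ltn0Sn n')) e mulnA.
by rewrite ltn_pmul2r ?bin_gt0 ?leq_addr // mulnC (leq_ltn_trans le_Ks) // -addn1 leq_add2l.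
Qed.

(** A finite module over a polynomial ring in [n] variables has a Hilbert function
    of order [s^(n-1)], whereas [n.+1] algebraically independent forms produce one
    of order [s^n]. *)
Lemma not_finite_over_fewer m0 (y : 'I_n -> {mpoly k[N.+1]}) :
  (forall i, y i \is 1.-homog) -> ~ finite_over I y m0.
Proof.
move=> hy finy.
have h1 (i : 'I_1) : (1 : {mpoly k[N.+1]}) \is 0.-homog by apply: dhomog1.
have [t0 cnt] := free_family_count I_deg h1 (fun=> x_homog) free_family_one.
have IX l e : ~ I (x l ^+ e).
  move=> Ix; have : ('X_l : {mpoly k[n.+1]}) ^+ e = 0.
    apply: (x_indep (s := (1 * e)%N)); first exact: homogXn (homog_var _ _).
    by rewrite rmorphXn /= mmapX mmap1U.
  by move/eqP; rewrite expf_eq0 (negPf (var_neq0 _ _)) andbF.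
move: (n) (x) x_homog x_indep y hy finy cnt IX => [|n'] z hz indz y hy finy cnt IX.
  have := finy m0 (z ord0 ^+ m0.+1) (leqnn _).
  have := homogXn m0.+1 (hz ord0); rewrite mul1n => hzX /(_ hzX)[g _].
  by rewrite big_ord0 subr0; apply: IX.
pose K := 'C(m0 + N, m0).
pose s := (t0 + K * n'.+1)%N.
have le_t0 : (t0 <= m0 + s)%N by lia.
have [J JE leJ] := cnt (m0 + s)%N le_t0.
have hmonh (i : 'I_('C(m0 + N, m0))) : ('X_[hmon i] : {mpoly k[N.+1]}) \is m0.-homog.
  by rewrite dhomogX /= mdeg_hmon.
have surj (w : dhomog N.+1 k (m0 + s)) :
    exists p, w - comb (x := fun=> y) hmonh (fun=> hy) (s := s) p \in J.
  have [p hp Ip] := finite_over_span I_ideal hy finy (dhomog_is_dhomog w).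
  by exists [ffun i => DHomog (hp i)]; apply/JE => /=; under eq_bigr => i _ do rewrite ffunE.
have := dim_surjective_modulo (comb_linear _ _ (s := s)) surj.
rewrite dimvf_ffun card_ord !dim_homog => leS; rewrite dim_homog in leJ.
have := leq_trans leJ leS; rewrite mul1n leq_add2r leqNgt => /negP; apply.
apply: leq_trans (binomial_outgrows (n' := n') (s := s) (K := K) (leq_addl _ _)) _.
rewrite -(bin_sub (leq_addr n'.+1 s)) -(bin_sub (leq_addr n'.+1 (m0 + s))) !addKn.
by apply: leq_bin2l; rewrite leq_add2r leq_addl.
Qed.

(** Starting from the coordinates, dependent linear forms are eliminated one by
    one. *)
Lemma noether_normalization : (n <= N)%N ->
  exists (y : 'I_n.+1 -> {mpoly k[N.+1]}) m0,
    [/\ forall i, y i \is 1.-homog, finite_over I y m0 & alg_indep I y].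
Proof.
move=> le_nN.
have descend q (y : 'I_(q + n.+1) -> {mpoly k[N.+1]}) m0 :
    (forall i, y i \is 1.-homog) -> finite_over I y m0 ->
  exists (y' : 'I_n.+1 -> {mpoly k[N.+1]}) m1, (forall i, y' i \is 1.-homog) /\ finite_over I y' m1.
  elim: q => [|q IHq] in y m0 *; first by exists y, m0.
  move=> hy finy; have [||e [F hF [nzF IF]]] := forms_dependent I_deg (q := (q + n.+1)%N) (y := y).
  - by rewrite addnS ltnS leq_addl.
  - exact: hy.
  have e_gt0 := relation_pos_degree I_ideal I_proper hF nzF IF.
  have [y' [m1 [hy' finy']]] := finite_over_reduce I_ideal hy finy hF e_gt0 nzF IF.
  exact: IHq hy' finy'.
have [y [m0 [hy finy]]] : exists (y : 'I_n.+1 -> {mpoly k[N.+1]}) m0,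
    (forall i, y i \is 1.-homog) /\ finite_over I y m0.
  have [v [hv finv]] : exists v : 'I_(N - n + n.+1) -> {mpoly k[N.+1]},
      (forall i, v i \is 1.-homog) /\ finite_over I v 0.
    rewrite (_ : N - n + n.+1 = N.+1)%N; last by lia.
    by exists (fun i => 'X_i); split; [apply: homog_var | apply: finite_over_variables].
  exact: descend hv finv.
exists y, m0; split=> // e F hF IF; apply/eqP/negPn/negP => nzF.
have e_gt0 := relation_pos_degree I_ideal I_proper hF nzF IF.
have [y' [m1 [hy' finy']]] := finite_over_reduce I_ideal hy finy hF e_gt0 nzF IF.
exact: not_finite_over_fewer hy' finy'.
Qed.

End NoetherNormalization.

(** * The generic rank *)

Section GenericRank.
Variables (k : numFieldType) (N n d : nat) (I : {mpoly k[N.+1]} -> Prop).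
Hypothesis I_prime : is_prime I.
Hypothesis I_deg : hilbert_degree I n d.
Variables (y : 'I_n.+1 -> {mpoly k[N.+1]}) (m0 : nat).
Hypothesis y_homog : forall i, y i \is 1.-homog.
Hypothesis y_finite : finite_over I y m0.
Hypothesis y_indep : alg_indep I y.

Let I_ideal : is_ideal I. Proof. by case: I_prime. Qed.

Let X0_neq0 e : ('X_ord0 : {mpoly k[n.+1]}) ^+ e != 0.
Proof. exact/expf_neq0/var_neq0. Qed.

Let homog_X0 e : ('X_ord0 : {mpoly k[n.+1]}) ^+ e \is e.-homog.
Proof. by have := homogXn e (homog_var k (ord0 : 'I_n.+1)); rewrite mul1n. Qed.

(** Ranks of free families are bounded by [d].  In a maximal one, any further
    form [mu] satisfies a relation, which after multiplication by powers of
    [y ord0] to equalize degrees expresses a multiple of [mu] in the family. *)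
Lemma maximal_free_family :
  exists r E, exists2 theta : 'I_r.+1 -> {mpoly k[N.+1]},
    [/\ forall i, theta i \is E.-homog, free_family I theta (fun=> y) & (r.+1 <= d)%N] &
    forall e mu, mu \is e.-homog -> exists s, exists2 b : {mpoly k[n.+1]},
      b \is (s + E).-homog /\ b != 0 &
      exists2 p, (forall i, p i \is (s + e).-homog) &
        I ((b \@ y) * mu - \sum_i theta i * (p i \@ y)).
Proof.
pose Q r := exists E, exists2 theta : 'I_r.+1 -> {mpoly k[N.+1]},
  forall i, theta i \is E.-homog & free_family I theta (fun=> y).
have Qd r : `[< Q r >] -> (r <= d)%N.
  move=> /asboolP[E [th hth fth]]; apply: ltnW.
  by apply: (free_family_le_degree I_deg hth _ fth).
have exQ : exists r, `[< Q r >].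
  exists 0%N; apply/asboolP; exists 0%N, (fun=> 1) => [i|]; first exact: dhomog1.
  move=> s p hp; rewrite big_ord1 mul1r => Ip i; rewrite ord1.
  exact: y_indep (hp _) Ip.
case: (ex_maxnP exQ Qd) => r /asboolP[E [th hth fth]] maxr.
exists r, E, th => [|e mu hmu].
  by split=> //; apply: (free_family_le_degree I_deg hth _ fth).
pose th' (i : 'I_r.+2) := oapp (fun j => th j * y ord0 ^+ e) (mu * y ord0 ^+ E) (unlift ord_max i).
have hth' i : th' i \is (E + e).-homog.
  rewrite /th'; case: unliftP => [j|] _ /=.
    by apply: homogM => //; have := homogXn e (y_homog ord0); rewrite mul1n.
  by rewrite addnC; apply: homogM => //; have := homogXn E (y_homog ord0); rewrite mul1n.
have : ~ free_family I th' (fun=> y).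
  move=> fth'; suff /asboolP/maxr : Q r.+1 by rewrite ltnn.
  by exists (E + e)%N, th'.
move=> /existsNP[s /existsNP[p /not_implyP[hp /not_implyP[Ip /existsNP[i0 nz]]]]].
have sumE : \sum_i th' i * (p i \@ y) =
    \sum_i th i * (('X_ord0 ^+ e * p (lift ord_max i)) \@ y) +
    (('X_ord0 ^+ E * p ord_max) \@ y) * mu.
  rewrite (bigD1_ord ord_max) //= addrC; congr (_ + _).
    apply: eq_bigr => i _; rewrite /th' liftK /=.
    by rewrite rmorphM rmorphXn /= mmapX mmap1U mulrA.
  rewrite /th' unlift_none /= rmorphM rmorphXn /= mmapX mmap1U.
  by rewrite mulrC [y _ ^+ _ * _]mulrC -!mulrA [mu * _]mulrC.
rewrite sumE in Ip.
exists s, ('X_ord0 ^+ E * p ord_max); first split.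
- by rewrite addnC; apply: homogM.
- rewrite mulf_neq0 //; apply/eqP => p0; rewrite p0 mulr0 mmap0 mul0r addr0 in Ip.
  have hXp i : 'X_ord0 ^+ e * p (lift ord_max i) \is (e + s).-homog by apply: homogM.
  have {Ip} := fth _ _ hXp Ip => Xp0; case: nz; case: (unliftP ord_max i0) => [j|] -> //.
  by have /eqP := Xp0 j; rewrite mulf_eq0 (negPf (X0_neq0 _)) => /eqP.
exists (fun i => - ('X_ord0 ^+ e * p (lift ord_max i))) => [i|].
  by rewrite rpredN addnC; apply: homogM.
under eq_bigr => i _ do rewrite mmapN mulrN.
by rewrite sumrN opprK addrC.
Qed.

(** Finitely many monomials generate the coordinate ring over [k[y]]; [b] is a
    product of denominators for all of them, and a power of a variable ensures
    that its degree is at least [E]. *)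
Lemma common_denominator :
  exists r E beta, exists theta : 'I_r.+1 -> {mpoly k[N.+1]}, exists b : {mpoly k[n.+1]},
    [/\ forall i, theta i \is E.-homog, free_family I theta (fun=> y), (r.+1 <= d)%N,
        b \is (beta + E).-homog /\ b != 0 &
        forall t f, f \is t.-homog -> exists2 phi, (forall i, phi i \is (beta + t).-homog) &
          I ((b \@ y) * f - \sum_i theta i * (phi i \@ y))].
Proof.
have [r [E [th [hth fth le_rd] denom]]] := maximal_free_family.
have /choice[s hs] : forall m : 'X_{1..N.+1 < m0.+1}, exists s, exists2 b : {mpoly k[n.+1]},
      b \is (s + E).-homog /\ b != 0 &
      exists2 p, (forall i, p i \is (s + mdeg m).-homog) &
        I ((b \@ y) * 'X_[m] - \sum_i th i * (p i \@ y)).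
  by move=> m; apply: denom; rewrite dhomogX.
have /choice[c hc] : forall m : 'X_{1..N.+1 < m0.+1}, exists b : {mpoly k[n.+1]},
      (b \is (s m + E).-homog /\ b != 0) /\
      exists2 p, (forall i, p i \is (s m + mdeg m).-homog) &
        I ((b \@ y) * 'X_[m] - \sum_i th i * (p i \@ y)).
  by move=> m; have [b] := hs m; exists b.
pose B := (\sum_(m : 'X_{1..N.+1 < m0.+1}) (s m + E))%N.
pose b := 'X_ord0 ^+ E * \prod_(m : 'X_{1..N.+1 < m0.+1}) c m.
exists r, E, B, th, b; split=> //.
  split; first by rewrite addnC; apply: homogM => //; apply: homog_prod => m _; case: (hc m) => [[]].
  by rewrite mulf_neq0 //; apply/prodf_neq0 => m _; case: (hc m) => [[]].
have mon (m : 'X_{1..N.+1}) : (mdeg m < m0.+1)%N ->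
  exists2 phi, (forall i, phi i \is (B + mdeg m).-homog) &
     I ((b \@ y) * 'X_[m] - \sum_i th i * (phi i \@ y)).
  move=> ltm; pose M := BMultinom ltm; have [[hcM _] [p hp Ip]] := hc M.
  pose c' := 'X_ord0 ^+ E * \prod_(m' | m' != M) c m'.
  have bE : b = c' * c M by rewrite /b (bigD1 M) //= mulrCA mulrC.
  exists (fun i => c' * p i) => [i|].
    have -> : (B + mdeg m = (E + \sum_(m' | m' != M) (s m' + E)) + (s M + mdeg m))%N.
      by rewrite /B (bigD1 M) //=; lia.
    apply: homogM => //; apply: homogM => //; apply: homog_prod => m' _.
    by case: (hc m') => [[]].
  have -> : (b \@ y) * 'X_[m] - \sum_i th i * ((c' * p i) \@ y) =
      (c' \@ y) * ((c M \@ y) * 'X_[M] - \sum_i th i * (p i \@ y)).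
    rewrite mulrBr mulr_sumr bE rmorphM /= mulrA; congr (_ - _).
    by apply: eq_bigr => i _; rewrite rmorphM /= mulrCA.
  by have [_ _ PM] := I_ideal; apply: PM.
have spanned e s' (p : 'I_'C(e + N, e) -> {mpoly k[n.+1]}) f : (e <= m0)%N ->
    (forall i, p i \is s'.-homog) -> I (f - \sum_i 'X_[hmon i] * (p i \@ y)) ->
  exists2 phi, (forall i, phi i \is (B + (e + s')).-homog) &
     I ((b \@ y) * f - \sum_i th i * (phi i \@ y)).
  move=> le_em hp If.
  have /choice[phi hphi] : forall j : 'I_'C(e + N, e), exists phi : 'I_r.+1 -> {mpoly k[n.+1]},
      (forall i, phi i \is (B + e).-homog) /\ I ((b \@ y) * 'X_[hmon j] - \sum_i th i * (phi i \@ y)).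
    move=> j; have [|phi] := mon (hmon j); first by rewrite mdeg_hmon.
    by rewrite mdeg_hmon; exists phi.
  exists (fun i => \sum_j phi j i * p j) => [i|].
    by rewrite addnA; apply: homog_sum => j _; apply: homogM => //; case: (hphi j).
  have -> : (b \@ y) * f - \sum_i th i * ((\sum_j phi j i * p j) \@ y) =
     (b \@ y) * (f - \sum_j 'X_[hmon j] * (p j \@ y)) +
     \sum_j (p j \@ y) * ((b \@ y) * 'X_[hmon j] - \sum_i th i * (phi j i \@ y)).
    have -> : \sum_i th i * ((\sum_j phi j i * p j) \@ y) =
        \sum_j (p j \@ y) * \sum_i th i * (phi j i \@ y).
      under [RHS]eq_bigr => j _ do rewrite mulr_sumr.
      rewrite exchange_big /=; apply: eq_bigr => i _.
      rewrite rmorph_sum mulr_sumr; apply: eq_bigr => j _.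
      by rewrite rmorphM /= mulrA mulrC.
    rewrite mulrBr mulr_sumr -addrA; congr (_ + _).
    under [X in _ = _ + X]eq_bigr => j _ do rewrite mulrBr mulrCA [(p j \@ y) * 'X_[_]]mulrC.
    by rewrite sumrB addrA addNr add0r.
  have [_ PD PM] := I_ideal; apply: PD; first exact: PM.
  by apply: ideal_sum => // j _; apply: PM; case: (hphi j).
move=> t f hf; have [le_tm|lt_mt] := leqP t m0.
  rewrite -{1}[t]addn0.
  apply: (@spanned t 0%N (fun i => (f@_(hmon i))%:MP)) => // [i|]; first exact: homogC.
  rewrite [X in X - _](homog_hmonE hf) -sumrB big1 => [|i _]; first by case: I_ideal.
  by rewrite mmapC mulrC mul_mpolyC subrr.
rewrite -(subnKC (ltnW lt_mt)) in hf *.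
have [p hp If] := finite_over_span I_ideal y_homog y_finite hf.
exact: spanned If.
Qed.

End GenericRank.

(** * Order of vanishing *)

Section LowOrder.
Variable A : idomainType.
Implicit Types (P Q U : {poly A}).

Definition order_ge c Q := forall j, (j < c)%N -> Q`_j = 0.

Lemma order_geP c Q : order_ge c Q -> Q = 'X^c * drop_poly c Q.
Proof.
move=> lowQ; rewrite -[LHS](poly_take_drop c) mulrC [take_poly _ _](_ : _ = 0) ?add0r //.
by apply/polyP => j; rewrite coef_take_poly coef0; case: ifP => // /lowQ.
Qed.

Lemma order_ge_XnM c Q : order_ge c ('X^c * Q).
Proof. by move=> j lt_jc; rewrite coefXnM lt_jc. Qed.

Lemma order_geM a b P Q : order_ge a P -> order_ge b Q -> order_ge (a + b)%N (P * Q).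
Proof. by move=> /order_geP-> /order_geP->; rewrite mulrACA -exprD; apply: order_ge_XnM. Qed.

Lemma order_geX c Q m : order_ge c Q -> order_ge (m * c)%N (Q ^+ m).
Proof.
by move=> lowQ; elim: m => [|m IHm] //; rewrite exprS mulSn; apply: order_geM.
Qed.

Lemma order_ge_unit c U Q : U`_0 != 0 -> order_ge c (U * Q) -> order_ge c Q.
Proof.
move=> nzU lowUQ j; have [m] := ubnP j; elim: m => // m IHm in j *.
rewrite ltnS => le_jm lt_jc; have := lowUQ j lt_jc; rewrite coefM big_ord_recl /=.
rewrite subn0 big1 ?addr0 => [/eqP|i _]; first by rewrite mulf_eq0 (negPf nzU) => /eqP.
by rewrite IHm ?mulr0 // /bump /=; move: (ltn_ord i); lia.
Qed.

Lemma order_ge_size c Q : (size Q <= c)%N -> order_ge c Q -> Q = 0.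
Proof.
move=> szQ lowQ; apply/polyP => j; rewrite coef0; have [/lowQ//|le_cj] := ltnP j c.
by apply: nth_default; apply: leq_trans le_cj.
Qed.

(** Dividing all entries by ['X^c] leaves a matrix whose constant term is singular. *)
Lemma order_ge_det r c (M : 'M[{poly A}]_r) (v : 'cV[A]_r) :
    (forall i j, order_ge c (M i j)) -> v != 0 ->
    (\matrix_(i, j) (M i j)`_c) *m v = 0 ->
  order_ge (r * c).+1%N (\det M).
Proof.
move=> lowM nzv Mv0; pose M'' := \matrix_(i, j) drop_poly c (M i j).
have -> : M = 'X^c *: M'' by apply/matrixP => i j; rewrite !mxE; apply: order_geP.
rewrite detZ -exprM mulnC -[X in order_ge X]addn1.
suff det0 : (\det M'').[0] = 0.
  apply: (order_geM (b := 1%N)); first by rewrite -['X^_]mulr1; apply: order_ge_XnM.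
  by case=> // _; rewrite -horner_coef0.
have -> : (\det M'').[0] = \det (\matrix_(i, j) (M i j)`_c).
  rewrite -[LHS]/(horner_eval 0 _) -det_map_mx; congr (\det _); apply/matrixP => i j.
  by rewrite !mxE -[LHS]/((drop_poly c (M i j)).[0]) horner_coef0 coef_drop_poly.
rewrite -det_tr; apply/eqP/det0P; exists v^T; last by rewrite -trmx_mul Mv0 trmx0.
by rewrite -trmx0 (inj_eq trmx_inj).
Qed.

End LowOrder.

Section GradedCoefficients.
Variables (k : fieldType) (n : nat).
Implicit Types (a : {mpoly k[n]}) (P Q : {poly {mpoly k[n]}}).

Definition graded_coefs Q := forall j, Q`_j \is j.-homog.

Lemma graded_coefsC a : a \is 0.-homog -> graded_coefs a%:P.
Proof. by move=> ha j; rewrite coefC; case: j => //= j; apply: rpred0. Qed.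

Lemma graded_coefsX a : a \is 1.-homog -> graded_coefs ('X * a%:P).
Proof.
move=> ha j; rewrite coefXM; case: j => [|j] /=; first exact: rpred0.
by rewrite coefC; case: j => //= j; apply: rpred0.
Qed.

Lemma graded_coefsD P Q : graded_coefs P -> graded_coefs Q -> graded_coefs (P + Q).
Proof. by move=> hP hQ j; rewrite coefD; apply: homogD. Qed.

Lemma graded_coefsM P Q : graded_coefs P -> graded_coefs Q -> graded_coefs (P * Q).
Proof.
move=> hP hQ j; rewrite coefM; apply: homog_sum => i _.
have := homogM (hP i) (hQ (j - i)%N); rewrite subnKC //.
by rewrite -ltnS.
Qed.

End GradedCoefficients.

Section TaylorAtPoint.
Variables (k : numFieldType) (n : nat) (o : 'I_n -> k).

Definition affine_point (i : 'I_n.+1) : k := oapp o 1 (unlift ord0 i).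

(** [taylor p] is the polynomial [p(1, o + T Y)] in [T]. *)
Definition taylor_arg (i : 'I_n.+1) : {poly {mpoly k[n]}} :=
  oapp (fun j => ((o j)%:MP)%:P + 'X * ('X_j)%:P) 1 (unlift ord0 i).

Notation taylor := (mmap (polyC \o @mpolyC n k) taylor_arg).

Lemma taylor_coef_homog p : graded_coefs (taylor p).
Proof.
elim/mpoly_ring_ind: p => [c|i|p q IHp IHq|p q IHp IHq].
- by rewrite mmapC; apply/graded_coefsC/homogC.
- rewrite mmapX mmap1U /taylor_arg; case: unliftP => [l|] _ /=.
    by apply: graded_coefsD; [apply/graded_coefsC/homogC | apply/graded_coefsX/homog_var].
  by apply: graded_coefsC; apply: dhomog1.
- rewrite mmapD.
  exact: (graded_coefsD IHp IHq).
rewrite rmorphM.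
exact: (graded_coefsM IHp IHq).
Qed.

Lemma taylor_size p D : p \is D.-homog -> (size (taylor p) <= D.+1)%N.
Proof.
move=> hp; rewrite /mmap big_seq; apply: (big_ind (fun Q : {poly _} => size Q <= D.+1)%N).
- by rewrite size_poly0.
- by move=> P Q sP sQ; rewrite (leq_trans (size_polyD _ _)) // geq_max sP.
move=> m /(dhomog_mf hp) /= <-; rewrite /= mul_polyC.
apply: (leq_trans (size_scale_leq _ _)); rewrite /mmap1 mdegE.
elim/big_rec2: _ => [|i e Q _ IH]; first by rewrite size_poly1.
apply: (leq_trans (size_polyMleq _ _)); move: IH.
suff : (size (taylor_arg i ^+ m i) <= (m i).+1)%N.
  by move: (size (taylor_arg i ^+ m i)) => a; move: (size e) (m i) => b c; lia.
have sz : (size (taylor_arg i) <= 2)%N.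
  rewrite /taylor_arg; case: unliftP => [l|] _ /=; last by rewrite size_poly1.
  rewrite (leq_trans (size_polyD _ _)) // geq_max (leq_trans (size_polyC_leq1 _)) //=.
  by rewrite mulrC (leq_trans (size_polyMleq _ _)) // size_polyX; have := size_polyC_leq1 ('X_l : {mpoly k[n]}); move: (size _) => a; lia.
apply: (leq_trans (size_poly_exp_leq _ _)); move: sz; move: (size _) => s sz.
by rewrite ltnS -[X in (_ <= X)%N]mul1n leq_mul2r; apply/orP; right; lia.
Qed.

Lemma taylor_eval p (z : 'I_n -> k) (T : k) :
  ((taylor p).[T%:MP]).@[z] = p.@[fun i => oapp (fun j => o j + T * z j) 1 (unlift ord0 i)].
Proof.
elim/mpoly_ring_ind: p => [c|i|p q IHp IHq|p q IHp IHq].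
- by rewrite mmapC hornerC !mevalC.
- rewrite mmapX mmap1U mevalXU /taylor_arg; case: unliftP => [l|] _ /=.
    by rewrite hornerD hornerM hornerX !hornerC mevalD mevalM !mevalC mevalXU.
  by rewrite hornerC meval1.
- rewrite mmapD hornerD.
  by rewrite [LHS]mevalD [RHS]mevalD; congr (_ + _); [exact: IHp | exact: IHq].
rewrite rmorphM hornerM.
by rewrite [LHS]mevalM [RHS]mevalM; congr (_ * _); [exact: IHp | exact: IHq].
Qed.

Lemma taylor_coef0 p : (taylor p)`_0 = (p.@[affine_point])%:MP.
Proof.
have h0 := taylor_coef_homog p 0; rewrite (homog0_const h0); congr (_%:MP).
rewrite -[LHS](@mevalC n _ (fun=> 0)) -(homog0_const h0) -horner_coef0.
have := taylor_eval p (fun=> 0) 0; rewrite mpolyC0 => ->.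
by apply: meval_eq => i; rewrite /affine_point; case: unliftP => [j|] _ //=; rewrite mulr0 addr0.
Qed.

Lemma taylor_eq0 p D : p \is D.-homog -> taylor p = 0 -> p = 0.
Proof.
move=> hp tp0.
have p1 (z : 'I_n.+1 -> k) : z ord0 = 1 -> p.@[z] = 0.
  move=> z0; have := taylor_eval p (fun j => z (lift ord0 j) - o j) 1.
  rewrite tp0 horner0 meval0 => ->; apply: meval_eq => i.
  by case: unliftP => [j|] -> //=; rewrite mul1r addrC subrK.
have /eqP : 'X_ord0 * p = 0.
  apply: mpoly_everywhere0 => z; rewrite mevalM mevalXU.
  have [->|nz] := eqVneq (z ord0) 0; first by rewrite mul0r.
  have -> : p.@[z] = p.@[fun i => z ord0 * ((z ord0)^-1 * z i)].
    by apply: meval_eq => i; rewrite mulVKf.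
  by rewrite (homog_eval_scale _ _ hp) p1 ?mulr0 // mulVf.
by rewrite mulf_eq0 (negPf (var_neq0 _ _)) => /eqP.
Qed.

(** What matters of Taylor expansion at [o] is that it is a graded ring morphism,
    does not raise degrees, and is injective on forms. *)
Lemma exists_taylor : exists tay : {rmorphism {mpoly k[n.+1]} -> {poly {mpoly k[n]}}},
  [/\ forall p, graded_coefs (tay p),
      forall c p j, (tay (c *: p))`_j = c *: (tay p)`_j,
      forall p, (tay p)`_0 = (p.@[affine_point])%:MP,
      forall D p, p \is D.-homog -> (size (tay p) <= D.+1)%N &
      forall D p, p \is D.-homog -> tay p = 0 -> p = 0].
Proof.
exists taylor; split; [exact: taylor_coef_homog | | exact: taylor_coef0 |
  by move=> D p; apply: taylor_size | by move=> D p; apply: taylor_eq0].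
by move=> c p j; rewrite /= mmapZ coefCM mul_mpolyC.
Qed.

End TaylorAtPoint.

(** * Multiplication matrices *)

Lemma mx_exp_homog (k : fieldType) n r e m (A : 'M[{mpoly k[n]}]_r.+1) :
  (forall i j, A i j \is e.-homog) -> forall i j, (A ^+ m) i j \is (m * e)%N.-homog.
Proof.
move=> hA; elim: m => [|m IHm] i j.
  by rewrite expr0 mxE mulrb; case: eqP => _; [apply: dhomog1 | apply: rpred0].
rewrite exprS mxE; apply: homog_sum => l _; rewrite mulSn.
exact: homogM (hA _ _) (IHm _ _).
Qed.

Lemma det_exp (A : comNzRingType) r m (M : 'M[A]_r.+1) : \det (M ^+ m) = \det M ^+ m.
Proof. by elim: m => [|m IHm]; rewrite ?expr0 ?det1 // !exprS det_mulmx IHm. Qed.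

Section MultiplicationMatrices.
Variables (k : fieldType) (N n r : nat) (I : {mpoly k[N]} -> Prop).
Hypothesis I_prime : is_prime I.
Variables (y : 'I_n -> {mpoly k[N]}) (theta : 'I_r.+1 -> {mpoly k[N]}).
Hypothesis theta_free : free_family I theta (fun=> y).
Implicit Types (g h : {mpoly k[N]}) (A B : 'M[{mpoly k[n]}]_r.+1) (b : {mpoly k[n]}).

Let I_ideal : is_ideal I. Proof. by case: I_prime. Qed.
Let I0 : I 0. Proof. by case: I_ideal. Qed.
Let ID f g : I f -> I g -> I (f + g). Proof. by case: I_ideal => _ + _; apply. Qed.
Let IM f g : I g -> I (f * g). Proof. by case: I_ideal => _ _; apply. Qed.

Definition acts g A := forall i, I (g * theta i - \sum_j theta j * (A i j \@ y)).

Lemma acts_congr g h A : I (h - g) -> acts g A -> acts h A.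
Proof.
move=> Ihg gA i; have := ID (idealMr (theta i) I_ideal Ihg) (gA i).
by rewrite mulrBl addrA subrK.
Qed.

Lemma acts_mul g h A B : acts g A -> acts h B -> acts (g * h) (A *m B).
Proof.
move=> gA hB i.
have -> : g * h * theta i - \sum_j theta j * ((A *m B) i j \@ y) =
   h * (g * theta i - \sum_j theta j * (A i j \@ y)) +
   \sum_j (A i j \@ y) * (h * theta j - \sum_l theta l * (B j l \@ y)).
  have -> : \sum_j theta j * ((A *m B) i j \@ y) =
      \sum_j (A i j \@ y) * \sum_l theta l * (B j l \@ y).
    under [RHS]eq_bigr => j _ do rewrite mulr_sumr.
    rewrite exchange_big /=; apply: eq_bigr => l _.
    rewrite mxE rmorph_sum mulr_sumr; apply: eq_bigr => j _.
    by rewrite rmorphM /= mulrCA.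
  under [X in _ = _ + X]eq_bigr => j _ do rewrite mulrBr.
  rewrite sumrB; have -> : \sum_j (A i j \@ y) * (h * theta j) = h * \sum_j theta j * (A i j \@ y).
    by rewrite mulr_sumr; apply: eq_bigr => j _; rewrite mulrC mulrA.
  by rewrite mulrBr mulrA [h * g]mulrC addrA subrK.
by apply: ID; [apply: IM | apply: ideal_sum => // j _; apply: IM].
Qed.

Lemma acts1 : acts 1 1%:M.
Proof.
move=> i; rewrite mul1r (bigD1 i) //= mxE eqxx rmorph1 mulr1 big1 ?addr0 ?subrr // => j ne_ji.
by rewrite mxE eq_sym (negPf ne_ji) mmap0 mulr0.
Qed.

Lemma acts_exp g A m : acts g A -> acts (g ^+ m) (A ^+ m).
Proof.
move=> gA; elim: m => [|m IHm]; first exact: acts1.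
by rewrite !exprS; apply: acts_mul.
Qed.

Lemma acts_scale g A b : acts g A -> acts ((b \@ y) * g) (b *: A).
Proof.
move=> gA i; have -> : (b \@ y) * g * theta i - \sum_j theta j * ((b *: A) i j \@ y) =
    (b \@ y) * (g * theta i - \sum_j theta j * (A i j \@ y)).
  rewrite mulrBr mulrA mulr_sumr; congr (_ - _); apply: eq_bigr => j _.
  by rewrite mxE rmorphM /= mulrCA.
exact: IM.
Qed.

Lemma acts_sum (T : finType) (g : T -> {mpoly k[N]}) (A : T -> 'M[{mpoly k[n]}]_r.+1) :
  (forall l, acts (g l) (A l)) -> acts (\sum_l g l) (\sum_l A l).
Proof.
move=> gA i; have -> : (\sum_l g l) * theta i - \sum_j theta j * ((\sum_l A l) i j \@ y) =
    \sum_l (g l * theta i - \sum_j theta j * (A l i j \@ y)).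
  rewrite sumrB mulr_suml; congr (_ - _); rewrite exchange_big /=.
  apply: eq_bigr => j _; rewrite summxE rmorph_sum mulr_sumr.
  by apply: eq_bigr => l _.
apply: ideal_sum => // l _; exact: gA.
Qed.

Lemma acts_unique s g A B :
    (forall i j, A i j \is s.-homog) -> (forall i j, B i j \is s.-homog) ->
  acts g A -> acts g B -> A = B.
Proof.
move=> hA hB gA gB; apply/matrixP => i j; apply/eqP; rewrite -subr_eq0; apply/eqP.
apply: (theta_free (s := s) (p := fun j => A i j - B i j)) => [l|]; first exact: homogB.
have := idealB I_ideal (gB i) (gA i); congr (I _).
rewrite opprB addrC addrA subrK -sumrB; apply: eq_bigr => l _.
by rewrite mmapB mulrBr.
Qed.

Lemma homog_part_neq0 (p : {mpoly k[n]}) : p != 0 -> exists e, pihomog mdeg e p != 0.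
Proof.
move=> nz; apply: contrapT => /forallNP p0; case/eqP: nz.
rewrite (pihomog_partitionE (mf := mdeg) (leqnn (msize p))) big1 // => e _.
by apply/eqP/negPn/negP/p0.
Qed.

(** A kernel vector of [A] gives a nonzero element of the free module that [g] kills
    modulo the prime [I].  One of its homogeneous components is still a nonzero
    kernel vector, as the entries of [A] have equal degrees. *)
Lemma acts_singular e g A :
  (forall i j, A i j \is e.-homog) -> acts g A -> \det A = 0 -> I g.
Proof.
move=> hA gA /eqP/det0P[v nzv vA0].
have /rV0Pn[i0 /homog_part_neq0[e1 nze]] := nzv.
pose w i := pihomog mdeg e1 (v 0 i).
have hw i : w i \is e1.-homog by apply: pihomogP.
have wA j : \sum_i w i * A i j = 0.
  have /(congr1 (fun M : 'rV__ => pihomog mdeg (e1 + e) (M 0 j))) := vA0.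
  rewrite !mxE pihomog0 raddf_sum /= => e0; rewrite -[RHS]e0; apply: eq_bigr => i _.
  by rewrite pihomogM.
have [_ _ Iprime] := I_prime.
have /Iprime[//|Iw] : I (g * \sum_i theta i * (w i \@ y)).
  have -> : g * (\sum_i theta i * (w i \@ y)) =
      \sum_i (w i \@ y) * (g * theta i - \sum_j theta j * (A i j \@ y)).
    under [RHS]eq_bigr => i _ do rewrite mulrBr.
    rewrite sumrB [X in _ = _ - X](_ : _ = 0) ?subr0.
      by rewrite mulr_sumr; apply: eq_bigr => i _; rewrite mulrA mulrC.
    under eq_bigr => i _ do rewrite mulr_sumr.
    rewrite exchange_big big1 //= => j _.
    under eq_bigr => i _ do rewrite mulrCA -rmorphM /=.
    by rewrite -mulr_sumr -rmorph_sum wA raddf0 mulr0.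
  by apply: ideal_sum => // i _; apply: IM.
by have /eqP := theta_free hw Iw i0; rewrite (negPf nze).
Qed.

End MultiplicationMatrices.

(** * The bound on the Hilbert function *)

Section HilbertBound.
Variables (k : numClosedFieldType) (N n d : nat) (I : {mpoly k[N.+1]} -> Prop).
Hypothesis I_prime : is_prime I.
Hypothesis I_deg : hilbert_degree I n d.
Variables (y : 'I_n.+1 -> {mpoly k[N.+1]}) (m0 : nat).
Hypothesis y_homog : forall i, y i \is 1.-homog.
Hypothesis y_finite : finite_over I y m0.
Hypothesis y_indep : alg_indep I y.

(** Monomials of degree at most [e] in [n] variables are counted as monomials of
    degree [e] in [n.+1] variables. *)
Definition dehomog (m : 'X_{1..n.+1}) : 'X_{1..n} := [multinom m (lift ord0 j) | j < n].

Lemma dehomog_surj e (m : 'X_{1..n}) : (mdeg m <= e)%N -> exists i, dehomog (@hmon n e i) = m.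
Proof.
move=> le_me; pose m' := [multinom oapp m (e - mdeg m)%N (unlift ord0 j) | j < n.+1].
have dm' : mdeg m' = e.
  rewrite mdegE big_ord_recl mnmE unlift_none /=.
  under eq_bigr => j _ do rewrite mnmE liftK /=.
  by rewrite -mdegE subnK.
have [i im] := hmon_surj dm'; exists i; apply/mnmP => j.
by rewrite im !mnmE liftK.
Qed.

Lemma exp_double_factor (A : comNzRingType) (a c : A) e q :
  (e + e = q.+1)%N -> (a * (a * c)) ^+ e = a ^+ q * (a * c ^+ e).
Proof. by move=> eq_e; rewrite !exprMn mulrA -exprD mulrA -exprSr eq_e. Qed.

Lemma coefM_order_ge (A : idomainType) c (P Q : {poly A}) :
  order_ge c P -> (P * Q)`_c = P`_c * Q`_0.
Proof.
move=> lowP; rewrite coefM big_ord_recr /= subnn big1 ?add0r // => i _.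
by rewrite lowP ?mul0r.
Qed.

Lemma common_column_eigenvector (r : nat) (T : finType) (C : T -> 'M[k]_r.+1) :
  (forall l l', C l *m C l' = C l' *m C l) ->
  exists2 v : 'cV[k]_r.+1, v != 0 & exists chi : T -> k, forall l, C l *m v = chi l *: v.
Proof.
move=> comC; have [||v nzv /allP stab] := @common_eigenvector k r.+1 [seq (C l)^T | l <- enum T].
- by [].
- move=> _ _ /mapP[l _ ->] /mapP[l' _ ->].
  by rewrite /comm_mx -!trmx_mul comC.
exists v^T; first by rewrite -trmx0 (inj_eq trmx_inj).
have /choice[chi hchi] : forall l, exists c, v *m (C l)^T = c *: v.
  move=> l; have /stab : (C l)^T \in [seq (C l)^T | l <- enum T].
    by apply: map_f; rewrite mem_enum.
  by move=> /sub_rVP[c ->]; exists c.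
exists chi => l; apply: trmx_inj; rewrite trmx_mul trmxK hchi.
by rewrite linearZ /= trmxK.
Qed.

(** Write [b f = sum phi_l theta_l] in the free module.  The conditions ask that all
    the [phi_l] vanish to order [t] at [o], and that the leading terms satisfy one
    relation, given by a character of the algebra of the fibre over [o], that is,
    by a common eigenvector of the matrices of multiplication by the [b theta_l]
    at [o].  The eigenvector is then killed by the leading part of the
    multiplication matrix [M] of [b^2 f], whose determinant has order more
    than [r.+1 * t].  For a large exponent [m] the matrix of [b f^m] still has
    polynomial entries; comparing [M^m] with it, the order of its determinant
    exceeds its degree. *)
Lemma hilbert_bound t : (0 < t)%N ->
    (forall f : {mpoly k[N.+1]}, f \is t.-homog -> I f -> f = 0) ->
  exists2 r, (r.+1 <= d)%N & ('C(t + N, t) <= r * 'C(t.-1 + n, t.-1) + 'C(t + n, t))%N.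
Proof.
move=> t_gt0 I_t.
have [r [E [beta [th [b [hth fth le_rd [hb nzb] denom]]]]]] :=
  common_denominator I_prime I_deg y_homog y_finite y_indep.
exists r => //; rewrite leqNgt; apply/negP => lt_cond.
have iI : is_ideal I by case: I_prime.
(* theta l itself need not map the free module to itself, but b * theta l does *)
have /choice[C hC] : forall l, exists C : 'M[{mpoly k[n.+1]}]_r.+1,
    (forall i j, C i j \is (beta + (E + E))%N.-homog) /\ acts I y th ((b \@ y) * th l) C.
  move=> l; have /choice[c hc] : forall i, exists phi : 'I_r.+1 -> {mpoly k[n.+1]},
      (forall j, phi j \is (beta + (E + E))%N.-homog) /\
      I ((b \@ y) * (th l * th i) - \sum_j th j * (phi j \@ y)).
    by move=> i; have [phi] := denom _ _ (homogM (hth l) (hth i)); exists phi.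
  exists (\matrix_(i, j) c i j); split=> [i j|i]; first by rewrite mxE; case: (hc i).
  have [_ Ic] := hc i; congr (I _): Ic; rewrite mulrA; congr (_ - _).
  by apply: eq_bigr => j _; rewrite mxE.
have homC l i j : C l i j \is (beta + (E + E))%N.-homog by case: (hC l).
have actC l : acts I y th ((b \@ y) * th l) (C l) by case: (hC l).
have homCC l l' i j : (C l *m C l') i j \is ((beta + (E + E)) + (beta + (E + E)))%N.-homog.
  by rewrite mxE; apply: homog_sum => s _; apply: homogM.
have comC l l' : C l *m C l' = C l' *m C l.
  apply: (acts_unique I_prime fth (homCC l l') (homCC l' l)).
    by apply: (acts_mul I_prime); apply: actC.
  by rewrite mulrC; apply: (acts_mul I_prime); apply: actC.
(* the factor 'X_ord0 makes it possible to normalize the first coordinate of the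
   point to 1 *)
have [eta] : exists eta, ('X_ord0 * b).@[eta] != 0.
  by apply: mpoly_neq0_point; rewrite mulf_neq0 ?var_neq0.
rewrite mevalM mevalXU mulf_eq0 negb_or => /andP[nz0 nzbeta].
pose o (j : 'I_n) := (eta ord0)^-1 * eta (lift ord0 j).
have oE : affine_point o =1 (fun i => (eta ord0)^-1 * eta i).
  by move=> i; rewrite /affine_point; case: unliftP => [j|] -> //=; rewrite mulVf.
have nzbo : b.@[affine_point o] != 0.
  by rewrite (meval_eq b oE) (homog_eval_scale _ _ hb) mulf_neq0 // expf_neq0 // invr_eq0.
have [tay [homtay tayZ tay0 taysize tayeq0]] := exists_taylor o.
pose Co l := map_mx (meval (affine_point o)) (C l).
have [v nzv [chi hchi]] : exists2 v : 'cV[k]_r.+1, v != 0 &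
    exists chi : 'I_r.+1 -> k, forall l, Co l *m v = chi l *: v.
  by apply: common_column_eigenvector => l l'; rewrite -!map_mxM comC.
have /choice[phi hphi] : forall a : 'I_'C(t + N, t), exists phi : 'I_r.+1 -> {mpoly k[n.+1]},
    (forall i, phi i \is (beta + t)%N.-homog) /\
    I ((b \@ y) * 'X_[hmon a] - \sum_i th i * (phi i \@ y)).
  move=> a; have [|p] := denom t 'X_[hmon a]; last by exists p.
  by rewrite dhomogX /= mdeg_hmon.
(* [inl]: terms of order less than t in phi_l for l != 0; [inr]: the same for
   phi_0, and the relation between the leading terms of all the phi_l *)
pose cond (a : 'I_'C(t + N, t)) (e : ('I_r * 'I_'C(t.-1 + n, t.-1)) + 'I_'C(t + n, t)) : k :=
  match e with
  | inl (l, i) => let m := dehomog (hmon i) in (tay (phi a (lift ord0 l)))`_(mdeg m)@_m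
  | inr i => let m := dehomog (hmon i) in
      if (mdeg m < t)%N then (tay (phi a ord0))`_(mdeg m)@_m
      else (\sum_l chi l *: (tay (phi a l))`_t)@_m
  end.
have [|c nzc c0] := @underdetermined_system k _ _ cond.
  by rewrite card_sum card_prod !card_ord.
pose f : {mpoly k[N.+1]} := \sum_a c a *: 'X_[hmon a].
pose ph l := \sum_a c a *: phi a l.
have hf : f \is t.-homog.
  by apply: homog_sum => a _; apply: homogZ; rewrite dhomogX /= mdeg_hmon.
have nzf : f != 0.
  have [a nza] := nzc; apply/eqP => /(congr1 (mcoeff (hmon a))); rewrite mcoeff0 raddf_sum /=.
  rewrite (bigD1 a) //= mcoeffZ mcoeffX eqxx mulr1 big1 ?addr0 => [/eqP|a' ne]; first exact/negP.
  by rewrite mcoeffZ mcoeffX (inj_eq (@hmon_inj _ _)) (negPf ne) mulr0.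
suff : I f by move/(I_t f hf)/eqP; apply/negP.
have hph l : ph l \is (beta + t)%N.-homog.
  by apply: homog_sum => a _; apply: homogZ; case: (hphi a).
have Iph : I ((b \@ y) * f - \sum_i th i * (ph i \@ y)).
  have -> : (b \@ y) * f - \sum_i th i * (ph i \@ y) =
     \sum_a (c a)%:MP * ((b \@ y) * 'X_[hmon a] - \sum_i th i * (phi a i \@ y)).
    under [RHS]eq_bigr => a _ do rewrite mulrBr.
    rewrite sumrB; congr (_ - _).
      by rewrite mulr_sumr; apply: eq_bigr => a _; rewrite -mul_mpolyC mulrCA.
    under [RHS]eq_bigr => a _ do rewrite mulr_sumr.
    rewrite exchange_big; apply: eq_bigr => i _ /=.
    rewrite rmorph_sum mulr_sumr; apply: eq_bigr => a _ /=.
    by rewrite mmapZ mulrCA.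
  by apply: ideal_sum => // a _; case: iI => _ _; apply; case: (hphi a).
have tayE l j : (tay (ph l))`_j = \sum_a c a *: (tay (phi a l))`_j.
  by rewrite raddf_sum /= coef_sum; apply: eq_bigr => a _; rewrite tayZ.
have lowph l : order_ge t (tay (ph l)).
  move=> j lt_jt; apply/mpolyP => m; rewrite mcoeff0.
  have [dm|ne] := eqVneq (mdeg m) j; last by apply: (homog_coef0 _ ne); apply: homtay.
  rewrite tayE raddf_sum /= -dm; case: (unliftP ord0 l) => [l'|] -> .
    have [|i im] := @dehomog_surj t.-1 m; first by rewrite dm; lia.
    rewrite -[RHS](c0 (inl (l', i))); apply: eq_bigr => a _.
    by rewrite /cond im mcoeffZ.
  have [|i im] := @dehomog_surj t m; first by rewrite dm; lia.
  rewrite -[RHS](c0 (inr i)); apply: eq_bigr => a _.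
  by rewrite /cond im dm lt_jt mcoeffZ.
have leadph : \sum_l chi l *: (tay (ph l))`_t = 0.
  apply/mpolyP => m; rewrite mcoeff0.
  have [dm|ne] := eqVneq (mdeg m) t; last first.
    apply: (homog_coef0 _ ne).
    by apply: homog_sum => l _; apply: homogZ; apply: homtay.
  have [|i im] := @dehomog_surj t m; first by rewrite dm.
  rewrite -[RHS](c0 (inr i)) raddf_sum /=.
  under [RHS]eq_bigr => a _ do rewrite /cond im dm ltnn raddf_sum mulr_sumr /=.
  rewrite exchange_big; apply: eq_bigr => l _ /=.
  rewrite mcoeffZ tayE raddf_sum mulr_sumr; apply: eq_bigr => a _ /=.
  by rewrite !mcoeffZ mulrCA.
clearbody f ph.
pose M := \sum_l ph l *: C l.
pose bf := (b \@ y) * ((b \@ y) * f).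
have actM : acts I y th bf M.
  have : acts I y th (\sum_l (ph l \@ y) * ((b \@ y) * th l)) M.
    by apply: (acts_sum I_prime) => l; apply: (acts_scale I_prime); apply: actC.
  apply: (acts_congr I_prime).
  have -> : bf - \sum_l (ph l \@ y) * ((b \@ y) * th l) =
      (b \@ y) * ((b \@ y) * f - \sum_i th i * (ph i \@ y)).
    rewrite mulrBr; congr (_ - _); rewrite mulr_sumr; apply: eq_bigr => l _.
    by rewrite mulrCA [th l * _]mulrC.
  by case: iI => _ _; apply.
pose e0 := ((beta + t) + (beta + (E + E)))%N.
have homM i j : M i j \is e0.-homog.
  by rewrite summxE; apply: homog_sum => l _; rewrite mxE; apply: homogM.
have low_det : order_ge (r.+1 * t).+1%N (tay (\det M)).
  rewrite -det_map_mx; apply: (order_ge_det (v := map_mx (@mpolyC n k) v)).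
  - move=> i j; rewrite mxE summxE raddf_sum => s lt_s; rewrite coef_sum big1 // => l _.
    rewrite mxE /= rmorphM /= -[s]addn0; apply: (@order_geM _ s.+1 0); rewrite ?addn0 //.
    by move=> s' lt_s'; apply: lowph; lia.
  - apply/eqP => /matrixP v0; case/eqP: nzv; apply/matrixP => i j.
    by have /eqP := v0 i j; rewrite !mxE mpolyC_eq0 => /eqP.
  apply/matrixP => i j; rewrite !mxE.
  transitivity (\sum_l (tay (ph l))`_t * ((Co l *m v) i j)%:MP).
    have Cov l : ((Co l *m v) i j)%:MP_[n] = \sum_s (Co l i s)%:MP * (v s j)%:MP.
      by rewrite mxE raddf_sum; apply: eq_bigr => s _; rewrite -mpolyCM.
    under [RHS]eq_bigr => l _ do rewrite Cov mulr_sumr.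
    rewrite exchange_big; apply: eq_bigr => s _ /=; rewrite !mxE summxE raddf_sum.
    rewrite coef_sum mulr_suml; apply: eq_bigr => l _ /=.
    rewrite mxE /= rmorphM coefM_order_ge; last exact: lowph.
    by rewrite -mulrA tay0 mxE.
  under eq_bigr => l _ do rewrite hchi mxE mpolyCM mulrA [_ * (chi l)%:MP]mulrC mul_mpolyC.
  by rewrite -mulr_suml leadph mul0r.
(* large enough for the order of \det G, at least m * (r.+1 * t + 1), to exceed its
   degree r.+1 * (beta + E + t * m) *)
pose m := (r.+1 * (beta + E)).+1.
have /choice[g hg] : forall i, exists p : 'I_r.+1 -> {mpoly k[n.+1]},
    (forall j, p j \is (beta + (t * m + E))%N.-homog) /\
    I ((b \@ y) * (f ^+ m * th i) - \sum_j th j * (p j \@ y)).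
  by move=> i; have [p] := denom _ _ (homogM (homogXn m hf) (hth i)); exists p.
pose G := \matrix_(i, j) g i j.
have homG i j : G i j \is (beta + (t * m + E))%N.-homog by rewrite mxE; case: (hg i).
have actG : acts I y th ((b \@ y) * f ^+ m) G.
  move=> i; have [_ Ig] := hg i; congr (I _): Ig; rewrite mulrA; congr (_ - _).
  by apply: eq_bigr => j _; rewrite mxE.
pose q := (2 * m).-1.
have MG : M ^+ m = b ^+ q *: G.
  have hl : (m * e0 = (beta + E) * q + (beta + (t * m + E)))%N.
    by rewrite /e0 /q /m; nia.
  apply: (acts_unique I_prime fth (s := (m * e0)%N)) (acts_exp I_prime m actM) _.
  - exact: mx_exp_homog.
  - by move=> i j; rewrite mxE hl; apply: homogM => //; apply: homogXn.
  suff -> : bf ^+ m = ((b ^+ q) \@ y) * ((b \@ y) * f ^+ m).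
    exact: (acts_scale I_prime (b ^+ q) actG).
  by rewrite rmorphXn /=; apply: exp_double_factor; rewrite /q /m; lia.
have detMG : \det M ^+ m = b ^+ (q * r.+1) * \det G by rewrite -det_exp MG detZ exprM.
have hdetG : \det G \is (r.+1 * (beta + (t * m + E)))%N.-homog by apply: homog_det.
have tayG0 : tay (\det G) = 0.
  apply: (@order_ge_size _ (m * (r.+1 * t).+1)%N).
    apply: leq_trans (taysize _ _ hdetG) _; rewrite /m; nia.
  apply: (@order_ge_unit _ _ (tay (b ^+ (q * r.+1)))).
    by rewrite tay0 mpolyC_eq0 rmorphXn /= expf_neq0.
  by rewrite -rmorphM -detMG rmorphXn /=; apply: order_geX.
have : \det M = 0.
  have /eqP : \det M ^+ m = 0 by rewrite detMG (tayeq0 _ _ hdetG tayG0) mulr0.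
  by rewrite expf_eq0 => /andP[_ /eqP].
move/(acts_singular I_prime fth homM actM).
have [_ _ Iprime] := I_prime.
have nIb : ~ I (b \@ y) by move/(y_indep hb)/eqP; apply/negP.
by move=> /Iprime[//|/Iprime[]].
Qed.

End HilbertBound.

(** * The inequality for the degree *)

Lemma prod_consecutive_fact a b : (a <= b)%N -> (a`! * \prod_(a + 1 <= i < b + 1) i = b`!)%N.
Proof. by move=> le_ab; rewrite !addn1 !fact_prod -big_cat_nat. Qed.

(** With [c = 'C(u + n, u)], the quotient of products is [u.+1 * 'C(u.+1 + N, u.+1) / c],
    and [u.+1 * 'C(u.+1 + n, u.+1) = (u + n).+1 * c]. *)
Lemma degree_bound_of_binomials N n u r d :
    (n <= N)%N -> (r.+1 <= d)%N ->
    ('C(u.+1 + N, u.+1) <= r * 'C(u + n, u) + 'C(u.+1 + n, u.+1))%N ->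
  (u.+1%:R)^-1 * ((\prod_(u + n + 1 <= k < u.+1 + N + 1) k%:R) /
       (\prod_(n + 1 <= k < N + 1) k%:R) - n%:R) <= d%:R :> rat.
Proof.
move=> le_nN lt_rd; rewrite -!natr_prod.
have := prod_consecutive_fact (leq_add (leqnSn u) le_nN).
have := prod_consecutive_fact le_nN.
move: (\prod_(u + n + 1 <= k < _) k)%N (\prod_(n + 1 <= k < _) k)%N => A B eB eA.
have := bin_fact (leq_addr n u); have := bin_fact (leq_addr N u.+1); have := bin_fact (leq_addr n u.+1).
rewrite !addKn; move: ('C(u + n, u)) ('C(u.+1 + N, u.+1)) ('C(u.+1 + n, u.+1)) => c CN Cn.
rewrite (factS u) (addSn u n) (factS (u + n)) => eCn eCN ec leC.
have un_gt0 : (0 < u`! * n`!)%N by rewrite muln_gt0 !fact_gt0.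
have B_gt0 : (0 < B)%N by move: (fact_gt0 N); rewrite -eB muln_gt0 => /andP[].
have c_gt0 : (0 < c)%N by move: (fact_gt0 (u + n)); rewrite -ec muln_gt0 => /andP[].
have eAB : (c * A = u.+1 * CN * B)%N.
  apply/eqP; rewrite -(eqn_pmul2l un_gt0); apply/eqP.
  rewrite mulnA [(_ * c)%N]mulnC ec eA -eCN -eB.
  by move: (u`!) (n`!) => a b; nia.
have eCn' : (u.+1 * Cn = (u + n).+1 * c)%N.
  apply/eqP; rewrite -(eqn_pmul2l un_gt0); apply/eqP.
  by move: eCn; rewrite -ec; move: (u`!) (n`!) => a b; nia.
have leA : (A <= (u.+1 * d + n) * B)%N.
  rewrite -(leq_pmul2l c_gt0) eAB mulnA leq_pmul2r //.
  by nia.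
rewrite ler_pdivrMl ?ltr0n // lerBlDr ler_pdivrMr ?ltr0n //.
by rewrite -natrM -natrD -natrM ler_nat.
Qed.

Theorem proposition3p8 (R : realType) (N n d delta : nat)
    (X : set 'rV[R[i]]_N.+1)
    (X_closed : proj_closed X)
    (X_proper : X <> proj_space R N)
    (X_nondeg : linearly_nondegenerate X)
    (X_connected : zariski_connected X)
    (X_dim : has_dim X n)
    (X_smooth : smooth_of_dim X n)
    (X_degree : has_degree X n d)
    (X_delta : is_initial_degree X delta) :
  (delta%:R - 1)^-1 *
    ((\prod_(delta + n - 1 <= k < delta + N) k%:R) /
       (\prod_(n + 1 <= k < N + 1) k%:R) - n%:R)
  <= d%:R :> rat.
Proof.
have [delta_gt0 _ delta_min] := X_delta.
case: delta delta_gt0 delta_min {X_delta} => [//|[|u]] _ delta_min.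
  by rewrite subrr invr0 mul0r ler0n.
have [v Xv] := X_connected.1.
have le_nN : (n <= N)%N := dim_le_ambient X_smooth (ex_intro _ v Xv).
have [P [x [pP IP PI hx indx]]] := ideal_prime X_closed X_connected X_smooth X_degree.
have [iP P1 _] := pP.
have P_deg : hilbert_degree P n d.
  have [Q [t0 hQ] szQ] := X_degree; exists Q => //; exists t0 => t /hQ[J JE eQ].
  exists J => // p; rewrite JE; split=> [Ip|Pp].
    exact: (IP t p (dhomog_is_dhomog p) Ip).
  exact: (PI t p (dhomog_is_dhomog p) Pp).
have [y [m0 [hy finy indy]]] := noether_normalization iP P1 P_deg hx indx le_nN.
have [||r lt_rd leC] := @hilbert_bound _ N n d P pP P_deg y m0 hy finy indy u.+1.
- by [].
- move=> f hf Pf; apply/eqP/negPn/negP => nzf.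
  have /delta_min : has_form X u.+1.
    by exists (DHomog hf) => [|w Xw]; [apply: nzf | apply: (PI _ f hf Pf)].
  by rewrite ltnn => /(_ isT).
have -> : u.+2%:R - 1 = u.+1%:R :> rat by rewrite -addn1 natrD addrK.
have -> : (u.+2 + n - 1 = u + n + 1)%N by lia.
have -> : (u.+2 + N = u.+1 + N + 1)%N by lia.
exact: degree_bound_of_binomials le_nN lt_rd leC.
Qed.
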